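(* $$\sum_{k=1}^\infty\frac{3S_4(k)-\frac{1}{k^4}}{k^2\binom{2k}{k}}=\frac{163\, \pi^6}{136080}.$$
   Context: $S_4(n):=\sum_{i=1}^n \frac{1}{i^4}$ is the generalized harmonic number of order $4$. *)

(* Defs.v *)
From Stdlib Require Import Reals.
From Coquelicot Require Import Coquelicot.
Open Scope R_scope.

Definition S4 (n : nat) : R := sum_n_m (fun i : nat => 1 / INR i ^ 4) 1 n.

(* Main.v *)
Require Import Defs.
From Stdlib Require Import Reals Factorial Lra Lia.
From Coquelicot Require Import Coquelicot.
Open Scope R_scope.

(** Write [w_k = 1 / (k^2 binom(2k,k))], and let [h] and [e] be the first and
    second elementary symmetric functions of the numbers [1/m^2], [m < k].
    The sum is a linear combination of three series with known values.

    Two of them come from generating functions in [t = x^2], for small [t > 0]: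
    - [sum_k w_k (3k^2+t)/(k^2-t) prod_(m<k) (1-t/m^2)
       = 2 sum_j (-1)^(j+1)/(j^2-t)]  ([is_series_alternating_zeta_gen]);
    - [3 sum_k w_k k^2/(k^2-t) prod_(m<k) (m^2-4t)/(m^2-t) = sum_j 1/(j^2-t)],
      the identity of Bailey, Borwein and Bradley ([is_series_even_zeta_gen]).

    Both are Wilf-Zeilberger summations: the right side is row 0 of an array
    [F n i] whose row sums tend to 0, and the difference of two consecutive row
    sums telescopes in [i] to the n-th term of the left side.  Comparing the
    coefficients of [t^2] gives
    - [sum w_k (4/k^4 - 4h/k^2 + 3e) = 2 eta(6)],
    - [3 sum w_k (1/k^4 - 3h/k^2 + 9e - 3 S4(k-1)) = zeta(6)].

    The third is [sum w_k e = PI^6/524880] ([is_series_esym2]), a value of the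
    power series of [arcsin^6].  With weights 3/4, -1/3 and 27/4 the terms in
    [h/k^2] and [e] cancel, and what is left is
    [w_k (3 S4(k-1) + 2/k^4) = w_k (3 S4(k) - 1/k^4)].

    There remain [zeta(6) = PI^6/945] and [eta(6) = (31/32) zeta(6)].  The
    former follows from Newton's identity and the limits [PI^2/3!], [PI^4/5!],
    [PI^6/7!] of the elementary symmetric functions of [1, 1/4, ..., 1/n^2],
    which Matsuoka's integrals of [t^(2j) cos^(2n) t] provide. *)

(** * Central binomial coefficients and elementary symmetric functions *)

Definition cb (n : nat) : R := Binomial.C (2 * n) n.

Lemma INR_S_pos (n : nat) : 0 < INR (S n).
Proof. apply lt_0_INR; lia. Qed.

Lemma INR_S_ge1 (n : nat) : 1 <= INR (S n).
Proof. rewrite S_INR; pose proof (pos_INR n); lra. Qed.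

Lemma INR_fact_S (n : nat) : INR (fact (S n)) = INR (S n) * INR (fact n).
Proof. rewrite fact_simpl, mult_INR; reflexivity. Qed.

Lemma cb_fact (n : nat) : cb n = INR (fact (2 * n)) / INR (fact n) ^ 2.
Proof.
  unfold cb, Binomial.C. replace (2 * n - n)%nat with n by lia.
  field; apply INR_fact_neq_0.
Qed.

Lemma cb_0 : cb 0 = 1.
Proof. rewrite cb_fact; simpl; field. Qed.

Lemma cb_S (n : nat) : cb (S n) = cb n * (2 * (2 * INR n + 1)) / INR (S n).
Proof.
  rewrite !cb_fact.
  replace (2 * S n)%nat with (S (S (2 * n))) by lia.
  rewrite !INR_fact_S, !S_INR, mult_INR; simpl (INR 2).
  pose proof (INR_fact_neq_0 n); pose proof (pos_INR n).
  field; split; lra.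
Qed.

Lemma cb_pos (n : nat) : 0 < cb n.
Proof.
  induction n as [|n IH]; [rewrite cb_0; lra|].
  rewrite cb_S; pose proof (pos_INR n); pose proof (INR_S_pos n).
  apply Rdiv_lt_0_compat; [nra|assumption].
Qed.

(** For [k >= 1] the ratio [binom(2k+2,k+1) / binom(2k,k)] is at least 3.  This
    growth makes all series weighted by [wt] absolutely convergent. *)
Lemma cb_ge_pow3 (n : nat) : 2 * 3 ^ n <= cb (S n).
Proof.
  induction n as [|n IH].
  - rewrite cb_S, cb_0; simpl; lra.
  - rewrite cb_S; pose proof (pos_INR n) as Hn; simpl (3 ^ S n).
    apply Rle_trans with (cb (S n) * 3); [lra|].
    unfold Rdiv; rewrite Rmult_assoc; apply Rmult_le_compat_l.
    + apply Rlt_le, cb_pos.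
    + apply Rmult_le_reg_r with (INR (S (S n))); [apply INR_S_pos|].
      rewrite Rmult_assoc, Rinv_l by (apply not_0_INR; lia).
      rewrite !S_INR; lra.
Qed.

Lemma is_lim_seq_inv_cb : is_lim_seq (fun n => / cb n) 0.
Proof.
  apply is_lim_seq_incr_1.
  apply is_lim_seq_le_le with (u := fun _ => 0) (w := fun n => (/ 3) ^ n).
  - intros n; pose proof (cb_pos (S n)) as Hp; pose proof (cb_ge_pow3 n) as Hc.
    assert (H3 : 0 < 3 ^ n) by (apply pow_lt; lra).
    split; [apply Rlt_le, Rinv_0_lt_compat, Hp|].
    rewrite pow_inv; apply Rinv_le_contravar; lra.
  - apply is_lim_seq_const.
  - apply is_lim_seq_geom; rewrite Rabs_pos_eq; lra.
Qed.

(** [esym n j] is the j-th elementary symmetric function of the numbers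
    [1/m^2], [1 <= m <= n]. *)
Fixpoint esym (n j : nat) {struct n} : R :=
  match n, j with
  | _, O => 1
  | O, S _ => 0
  | S m, S i => esym m (S i) + esym m i / INR (S m) ^ 2
  end.

Lemma esym_0 (n : nat) : esym n 0 = 1.
Proof. destruct n; reflexivity. Qed.

Lemma esym_S (n j : nat) :
  esym (S n) (S j) = esym n (S j) + esym n j / INR (S n) ^ 2.
Proof. reflexivity. Qed.

Lemma esym_nonneg (n j : nat) : 0 <= esym n j.
Proof.
  revert j; induction n as [|n IH]; intros [|j];
    try (rewrite esym_0; lra); [simpl; lra|].
  rewrite esym_S; pose proof (INR_S_pos n) as Hp.
  apply Rplus_le_le_0_compat; [apply IH|].
  apply Rdiv_le_0_compat; [apply IH|]. apply pow_lt, Hp.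
Qed.

Lemma inv_sqr_telescope (n : nat) :
  / INR (S (S n)) ^ 2 <= / INR (S n) - / INR (S (S n)).
Proof.
  pose proof (INR_S_pos n) as Hp; rewrite (S_INR (S n)).
  set (x := INR (S n)) in *.
  replace (/ x - / (x + 1)) with (/ (x * (x + 1))) by (field; lra).
  apply Rinv_le_contravar; nra.
Qed.

Lemma esym_1_le (n : nat) : esym n 1 <= 2.
Proof.
  assert (H : forall m, esym (S m) 1 <= 2 - / INR (S m)).
  { induction m as [|m IH]; [simpl; lra|].
    rewrite esym_S, esym_0; pose proof (inv_sqr_telescope m).
    unfold Rdiv; lra. }
  destruct n as [|n]; [simpl; lra|].
  pose proof (H n); pose proof (Rinv_0_lt_compat _ (INR_S_pos n)); lra.
Qed.

(** By induction on [j], since [esym n (S j)] is the sum of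
    [esym (m-1) j / m^2] over [m <= n] and the [1/m^2] sum to at most 2. *)
Lemma esym_le (n j : nat) : esym n j <= 2 ^ j.
Proof.
  revert n; induction j as [|j IH]; intros n; [rewrite esym_0; simpl; lra|].
  assert (H : esym n (S j) <= 2 ^ j * esym n 1).
  { induction n as [|n IHn]; [simpl; lra|].
    rewrite !esym_S, esym_0.
    assert (Hi : 0 < / INR (S n) ^ 2) by (apply Rinv_0_lt_compat, pow_lt, INR_S_pos).
    pose proof (IH n); unfold Rdiv. nra. }
  pose proof (esym_1_le n); assert (0 < 2 ^ j) by (apply pow_lt; lra).
  simpl; nra.
Qed.

Lemma S4_0 : S4 0 = 0.
Proof. unfold S4; apply (sum_n_m_zero (G := R_AbelianMonoid)); lia. Qed.

Lemma S4_S (n : nat) : S4 (S n) = S4 n + / INR (S n) ^ 4.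
Proof.
  unfold S4; rewrite sum_n_Sm by lia. unfold plus, Rdiv; cbn -[INR pow]; ring.
Qed.

Lemma S4_bounds (n : nat) : 0 <= S4 n <= esym n 1.
Proof.
  induction n as [|n IH]; [rewrite S4_0; simpl; lra|].
  rewrite S4_S, esym_S, esym_0.
  pose proof (INR_S_ge1 n) as Hp.
  assert (H4 : 0 < / INR (S n) ^ 4) by (apply Rinv_0_lt_compat, pow_lt; lra).
  assert (/ INR (S n) ^ 4 <= / INR (S n) ^ 2).
  { apply Rinv_le_contravar; [apply pow_lt; lra|apply Rle_pow; [lra|lia]]. }
  unfold Rdiv; lra.
Qed.

Definition wt (n : nat) : R := / (INR (S n) ^ 2 * cb (S n)).

Lemma wt_pos (n : nat) : 0 < wt n.
Proof.
  apply Rinv_0_lt_compat, Rmult_lt_0_compat; [apply pow_lt, INR_S_pos|apply cb_pos].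
Qed.

Lemma wt_le (n : nat) : wt n <= (/ 3) ^ n.
Proof.
  unfold wt; rewrite pow_inv. pose proof (cb_ge_pow3 n) as Hc.
  assert (H3 : 0 < 3 ^ n) by (apply pow_lt; lra).
  pose proof (INR_S_ge1 n).
  apply Rinv_le_contravar; [lra|].
  assert (1 <= INR (S n) ^ 2) by (apply pow_R1_Rle; assumption). nra.
Qed.

(** * Second-order expansions and their coefficients *)

(** A second-order expansion at [0+] with an explicit constant: the constant is
    a parameter so that the expansions of the terms of a series can be summed.
    The bound 1/8 keeps [m^2 - t] and [m^2 - 4t] away from 0 for [m >= 1]. *)
Definition jet (M : R) (f : R -> R) (a b c : R) : Prop :=
  forall t, 0 < t < 1 / 8 -> Rabs (f t - (a + b * t + c * t ^ 2)) <= M * t ^ 3.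

Lemma jet_bound_nonneg (M : R) (f : R -> R) (a b c : R) : jet M f a b c -> 0 <= M.
Proof.
  intros H; pose proof (H (1 / 16) ltac:(lra)) as H1.
  pose proof (Rabs_pos (f (1 / 16) - (a + b * (1 / 16) + c * (1 / 16) ^ 2))); lra.
Qed.

Lemma jet_unique (M M' : R) (f : R -> R) (a b c a' b' c' : R) :
  jet M f a b c -> jet M' f a' b' c' -> c = c'.
Proof.
  intros H H'.
  assert (HM := jet_bound_nonneg _ _ _ _ _ H).
  assert (HM' := jet_bound_nonneg _ _ _ _ _ H').
  assert (D : forall t, 0 < t < 1 / 8 ->
    Rabs ((a - a') + (b - b') * t + (c - c') * t ^ 2) <= (M + M') * t ^ 3).
  { intros t Ht; pose proof (H t Ht) as H1; pose proof (H' t Ht) as H2.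
    apply Rabs_le_between in H1; apply Rabs_le_between in H2.
    apply Rabs_le_between; split; lra. }
  (* the second difference of the quadratic on s, 2s, 3s isolates its leading
     coefficient *)
  assert (E : forall s, 0 < s < 1 / 24 -> Rabs (c - c') <= 22 * (M + M') * s).
  { intros s Hs.
    pose proof (D s ltac:(lra)) as D1; pose proof (D (2 * s) ltac:(lra)) as D2;
      pose proof (D (3 * s) ltac:(lra)) as D3.
    apply Rabs_le_between in D1; apply Rabs_le_between in D2;
      apply Rabs_le_between in D3.
    assert (Hs2 : 0 < s ^ 2) by (apply pow_lt; lra).
    apply Rabs_le_between; split; apply Rmult_le_reg_r with (s ^ 2); try lra; nra. }
  destruct (Req_dec c c') as [|Hne]; [assumption|exfalso].
  assert (Hd : 0 < Rabs (c - c')) by (apply Rabs_pos_lt; lra).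
  set (d := Rabs (c - c')) in *.
  set (s := Rmin (1 / 48) (d / (44 * (M + M' + 1)))).
  assert (Hq : 0 < d / (44 * (M + M' + 1))) by (apply Rdiv_lt_0_compat; lra).
  assert (Hs : 0 < s <= 1 / 48).
  { split; [apply Rmin_pos; lra|apply Rmin_l]. }
  pose proof (E s ltac:(lra)) as Es.
  assert (Hs2 : s * (44 * (M + M' + 1)) <= d).
  { apply Rle_trans with (d / (44 * (M + M' + 1)) * (44 * (M + M' + 1))).
    - apply Rmult_le_compat_r; [lra|apply Rmin_r].
    - right; field; lra. }
  nra.
Qed.

(** The constant in front of [M] is only the bound [L] on the second factor.
    When that factor is at most 1 in absolute value, the error constants of an
    iterated product therefore grow linearly, not exponentially. *)
Lemma jet_mult (M M' K K' L : R) (f g : R -> R) (a b c a' b' c' : R) :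
  jet M f a b c -> jet M' g a' b' c' ->
  (forall t, 0 < t < 1 / 8 -> Rabs (g t) <= L) ->
  Rabs a <= K -> Rabs b <= K -> Rabs c <= K -> Rabs b' <= K' -> Rabs c' <= K' ->
  jet (M * L + 3 * K * M' + 3 * K * K') (fun t => f t * g t)
    (a * a') (a * b' + b * a') (a * c' + b * b' + c * a').
Proof.
  intros Hf Hg HL Ha Hb Hc Hb' Hc' t Ht.
  pose proof (jet_bound_nonneg _ _ _ _ _ Hf) as HM.
  pose proof (jet_bound_nonneg _ _ _ _ _ Hg) as HM'.
  specialize (Hf t Ht); specialize (Hg t Ht); specialize (HL t Ht).
  set (p := a + b * t + c * t ^ 2) in *.
  set (q := a' + b' * t + c' * t ^ 2) in *.
  assert (HK : 0 <= K) by (eapply Rle_trans; [apply Rabs_pos|exact Ha]).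
  assert (HK' : 0 <= K') by (eapply Rle_trans; [apply Rabs_pos|exact Hb']).
  assert (Ht3 : 0 < t ^ 3) by (apply pow_lt; lra).
  replace (f t * g t - _)
    with ((f t - p) * g t + p * (g t - q)
          + (b * c' + c * b' + c * c' * t) * t ^ 3) by (unfold p, q; ring).
  assert (P1 : Rabs ((f t - p) * g t) <= M * t ^ 3 * L).
  { rewrite Rabs_mult; apply Rmult_le_compat; auto using Rabs_pos. }
  assert (P2 : Rabs (p * (g t - q)) <= 3 * K * (M' * t ^ 3)).
  { rewrite Rabs_mult; apply Rmult_le_compat; auto using Rabs_pos.
    apply Rabs_le_between in Ha; apply Rabs_le_between in Hb;
      apply Rabs_le_between in Hc.
    apply Rabs_le_between; unfold p.
    assert (0 <= t ^ 2 <= 1) by (simpl; split; nra). split; nra. }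
  assert (P3 : Rabs ((b * c' + c * b' + c * c' * t) * t ^ 3) <= 3 * K * K' * t ^ 3).
  { rewrite Rabs_mult, (Rabs_pos_eq (t ^ 3)) by lra.
    apply Rmult_le_compat_r; [lra|].
    assert (Q : forall x y, Rabs x <= K -> Rabs y <= K' -> Rabs (x * y) <= K * K').
    { intros x y Hx Hy; rewrite Rabs_mult; apply Rmult_le_compat; auto using Rabs_pos. }
    pose proof (Q b c' Hb Hc'); pose proof (Q c b' Hc Hb');
      pose proof (Q c c' Hc Hc').
    assert (Rabs (c * c' * t) <= K * K').
    { rewrite Rabs_mult, (Rabs_pos_eq t) by lra.
      pose proof (Rabs_pos (c * c')); nra. }
    eapply Rle_trans; [apply Rabs_triang|].
    eapply Rle_trans; [apply Rplus_le_compat_r, Rabs_triang|]. lra. }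
  eapply Rle_trans; [apply Rabs_triang|].
  eapply Rle_trans; [apply Rplus_le_compat_r, Rabs_triang|]. lra.
Qed.

Lemma jet_scal (l M : R) (f : R -> R) (a b c : R) :
  jet M f a b c -> jet (Rabs l * M) (fun t => l * f t) (l * a) (l * b) (l * c).
Proof.
  intros H t Ht.
  replace (_ - _) with (l * (f t - (a + b * t + c * t ^ 2))) by ring.
  rewrite Rabs_mult, Rmult_assoc; apply Rmult_le_compat_l; [apply Rabs_pos|auto].
Qed.

Lemma jet_ext (M M' : R) (f g : R -> R) (a b c a' b' c' : R) :
  jet M f a b c -> M <= M' -> (forall t, 0 < t < 1 / 8 -> f t = g t) ->
  a = a' -> b = b' -> c = c' -> jet M' g a' b' c'.
Proof.
  intros H HM Hfg <- <- <- t Ht; rewrite <- (Hfg t Ht).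
  eapply Rle_trans; [apply (H t Ht)|].
  apply Rmult_le_compat_r; [apply pow_le; lra|assumption].
Qed.

Lemma jet_series (M a b c : nat -> R) (f : nat -> R -> R) (F : R -> R) :
  (forall n, jet (M n) (f n) (a n) (b n) (c n)) ->
  ex_series M -> ex_series a -> ex_series b -> ex_series c ->
  (forall t, 0 < t < 1 / 8 -> is_series (fun n => f n t) (F t)) ->
  jet (Series M) F (Series a) (Series b) (Series c).
Proof.
  intros Hj HM Ha Hb Hc HF t Ht.
  set (r := fun n => f n t - (a n + b n * t + c n * t ^ 2)).
  assert (Hr : is_series r (F t - (Series a + Series b * t + Series c * t ^ 2))).
  { apply (is_series_minus (fun n => f n t)); [auto|].
    apply (is_series_plus (fun n => a n + b n * t)).
    - apply (is_series_plus a); [apply Series_correct, Ha|].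
      apply is_series_scal_r, Series_correct, Hb.
    - apply is_series_scal_r, Series_correct, Hc. }
  rewrite <- (is_series_unique _ _ Hr).
  assert (HMt : ex_series (fun n => M n * t ^ 3)) by (apply ex_series_scal_r, HM).
  rewrite <- Series_scal_r.
  assert (Hle : forall n, 0 <= Rabs (r n) <= M n * t ^ 3).
  { intros n; split; [apply Rabs_pos|apply (Hj n t Ht)]. }
  eapply Rle_trans; [apply Series_Rabs|apply Series_le; assumption].
  apply (ex_series_le (fun n => Rabs (r n)) (fun n => M n * t ^ 3)); [|assumption].
  intros n; unfold norm; simpl; unfold abs; simpl; rewrite Rabs_Rabsolu; apply Hle.
Qed.

(** * The generating function of the even zeta values *)

Lemma is_series_telescope (g : nat -> R) :
  is_lim_seq g 0 -> is_series (fun k => g k - g (S k)) (g 0%nat).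
Proof.
  intros Hg.
  assert (E : forall n, sum_n (fun k => g k - g (S k)) n = g 0%nat - g (S n)).
  { induction n as [|n IH]; [apply sum_O|].
    rewrite sum_Sn, IH; unfold plus; simpl; ring. }
  change (is_lim_seq (sum_n (fun k => g k - g (S k))) (g 0%nat)).
  apply is_lim_seq_ext with (fun n => g 0%nat - g (S n)); [intros n; symmetry; apply E|].
  replace (g 0%nat) with (g 0%nat - 0) at 1 by ring.
  apply is_lim_seq_minus'; [apply is_lim_seq_const|].
  apply (is_lim_seq_incr_1 g); exact Hg.
Qed.

Lemma is_lim_seq_inv_S : is_lim_seq (fun n => / INR (S n)) 0.
Proof.
  apply (is_lim_seq_incr_1 (fun n => / INR n)).
  replace (Finite 0) with (Rbar_inv p_infty) by reflexivity.
  apply is_lim_seq_inv; [apply is_lim_seq_INR|discriminate].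
Qed.

Lemma is_lim_seq_squeeze0 (u v : nat -> R) :
  (forall n, Rabs (u n) <= v n) -> is_lim_seq v 0 -> is_lim_seq u 0.
Proof.
  intros H Hv. apply is_lim_seq_abs_0.
  apply is_lim_seq_le_le with (u := fun _ => 0) (w := v);
    [|apply is_lim_seq_const|assumption].
  intros n; split; [apply Rabs_pos|apply H].
Qed.

Lemma ex_series_Rabs_le (u v : nat -> R) :
  (forall n, Rabs (u n) <= v n) -> ex_series v -> ex_series u.
Proof. intros H Hv; apply (ex_series_le u v); assumption. Qed.

Lemma ex_series_inv_sqr : ex_series (fun i => / INR (S i) ^ 2).
Proof.
  apply ex_series_Rabs_le with (fun i => 2 * (/ INR (S i) - / INR (S (S i)))).
  - intros i; pose proof (INR_S_ge1 i) as H; rewrite (S_INR (S i)); set (x := INR (S i)) in *.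
    rewrite Rabs_pos_eq by (apply Rlt_le, Rinv_0_lt_compat, pow_lt; lra).
    replace (2 * (/ x - / (x + 1))) with (/ (x * (x + 1) / 2)) by (field; lra).
    apply Rinv_le_contravar; nra.
  - apply (ex_series_scal_l 2 (fun i => / INR (S i) - / INR (S (S i)))).
    exists (/ INR 1); apply (is_series_telescope (fun i => / INR (S i))).
    apply is_lim_seq_inv_S.
Qed.

(** The summation principle behind both generating functions.  The hypothesis
    makes the row sums of [F] tend to 0, so that the differences [u] of
    consecutive row sums add up to the sum of row 0. *)
Lemma is_series_wz (F : nat -> nat -> R) (u : nat -> R) (c : R) :
  (forall n i, Rabs (F n i) <= c / cb n * / INR (S i) ^ 2) ->
  (forall n, Series (F n) - Series (F (S n)) = u n) ->
  is_series u (Series (F 0%nat)).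
Proof.
  intros Hb Hu.
  apply is_series_ext with (fun n => Series (F n) - Series (F (S n)));
    [assumption|].
  apply (is_series_telescope (fun n => Series (F n))).
  apply is_lim_seq_squeeze0
    with (fun n => c * Series (fun i => / INR (S i) ^ 2) * / cb n).
  - intros n.
    replace (c * _ * _) with (c / cb n * Series (fun i => / INR (S i) ^ 2))
      by (unfold Rdiv; ring).
    rewrite <- Series_scal_l.
    assert (Hex : ex_series (fun i => c / cb n * / INR (S i) ^ 2))
      by apply (ex_series_scal_l (c / cb n) (fun i => / INR (S i) ^ 2)), ex_series_inv_sqr.
    eapply Rle_trans; [apply Series_Rabs|apply Series_le; [|exact Hex]].
    + apply ex_series_Rabs_le with (2 := Hex).
      intros i; rewrite Rabs_Rabsolu; apply Hb.
    + intros i; split; [apply Rabs_pos|apply Hb].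
  - replace 0 with (c * Series (fun i => / INR (S i) ^ 2) * 0) by ring.
    apply (is_lim_seq_scal_l (fun n => / cb n) _ 0), is_lim_seq_inv_cb.
Qed.

Lemma ex_series_wz (F : nat -> nat -> R) (c : R) :
  (forall n i, Rabs (F n i) <= c / cb n * / INR (S i) ^ 2) ->
  forall n, ex_series (F n).
Proof.
  intros H n; apply ex_series_Rabs_le with (1 := H n).
  apply (ex_series_scal_l (c / cb n) (fun i => / INR (S i) ^ 2)), ex_series_inv_sqr.
Qed.

Lemma sqr_sub_pos (y t : R) : 1 <= y -> 0 < t < 1 / 8 -> y ^ 2 / 2 <= y ^ 2 - t /\ 1 / 2 < y ^ 2 - t.
Proof. intros; simpl; split; nra. Qed.

Fixpoint prod_ratio (n : nat) (t : R) : R :=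
  match n with
  | O => 1
  | S m => prod_ratio m t * ((INR (S m) ^ 2 - 4 * t) / (INR (S m) ^ 2 - t))
  end.

Lemma prod_ratio_factor_le1 (n : nat) (t : R) : 0 < t < 1 / 8 ->
  Rabs ((INR (S n) ^ 2 - 4 * t) / (INR (S n) ^ 2 - t)) <= 1.
Proof.
  intros Ht; pose proof (INR_S_ge1 n) as H; set (y := INR (S n)) in *.
  destruct (sqr_sub_pos y t H Ht) as [_ H1].
  assert (1 <= y ^ 2) by (simpl; nra).
  rewrite Rabs_pos_eq.
  - apply Rmult_le_reg_r with (y ^ 2 - t); [lra|].
    unfold Rdiv; rewrite Rmult_assoc, Rinv_l by lra; lra.
  - apply Rdiv_le_0_compat; lra.
Qed.

Lemma prod_ratio_le1 (n : nat) (t : R) : 0 < t < 1 / 8 -> Rabs (prod_ratio n t) <= 1.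
Proof.
  intros Ht; induction n as [|n IH]; [simpl; rewrite Rabs_R1; lra|].
  cbn [prod_ratio]; rewrite Rabs_mult.
  pose proof (prod_ratio_factor_le1 n t Ht).
  pose proof (Rabs_pos (prod_ratio n t)).
  pose proof (Rabs_pos ((INR (S n) ^ 2 - 4 * t) / (INR (S n) ^ 2 - t))). nra.
Qed.

(** This is [prod_(1<=m<=n) (m^2-t) / prod_(0<=i<=n) ((y+i)^2-t)]. *)
Fixpoint ratio_kernel (t : R) (n : nat) (y : R) : R :=
  match n with
  | O => / (y ^ 2 - t)
  | S m => ratio_kernel t m y * ((INR (S m) ^ 2 - t) / ((y + INR (S m)) ^ 2 - t))
  end.

Lemma ratio_kernel_shift (t : R) (n : nat) (y : R) : 0 < t < 1 / 8 -> 1 <= y ->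
  ratio_kernel t n (y + 1) = ratio_kernel t n y * ((y ^ 2 - t) / ((y + INR (S n)) ^ 2 - t)).
Proof.
  intros Ht Hy; induction n as [|n IH].
  - cbn [ratio_kernel]; simpl (INR 1).
    destruct (sqr_sub_pos y t Hy Ht); destruct (sqr_sub_pos (y + 1) t ltac:(lra) Ht).
    field; lra.
  - cbn [ratio_kernel]; rewrite IH, (S_INR (S n)).
    pose proof (INR_S_ge1 n) as Hn; set (x := INR (S n)) in *.
    destruct (sqr_sub_pos (y + x) t ltac:(lra) Ht).
    destruct (sqr_sub_pos (y + (x + 1)) t ltac:(lra) Ht).
    replace (y + 1 + x) with (y + (x + 1)) by ring. field; lra.
Qed.

Lemma ratio_kernel_1 (t : R) (n : nat) : 0 < t < 1 / 8 -> ratio_kernel t n 1 = / (INR (S n) ^ 2 - t).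
Proof.
  intros Ht; induction n as [|n IH]; [reflexivity|].
  cbn [ratio_kernel]; rewrite IH, (S_INR (S n)).
  pose proof (INR_S_ge1 n) as Hn; set (x := INR (S n)) in *.
  destruct (sqr_sub_pos x t ltac:(lra) Ht).
  destruct (sqr_sub_pos (x + 1) t ltac:(lra) Ht).
  replace (1 + x) with (x + 1) by ring. field; lra.
Qed.

Lemma ratio_kernel_bounds (t : R) (n : nat) (y : R) : 0 < t < 1 / 8 -> 1 <= y ->
  0 <= ratio_kernel t n y <= 2 * / y ^ 2.
Proof.
  intros Ht Hy; induction n as [|n IH].
  - cbn [ratio_kernel]. destruct (sqr_sub_pos y t Hy Ht).
    split; [apply Rlt_le, Rinv_0_lt_compat; lra|].
    replace (2 * / y ^ 2) with (/ (y ^ 2 / 2)) by (field; lra).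
    apply Rinv_le_contravar; nra.
  - cbn [ratio_kernel].
    pose proof (INR_S_ge1 n) as Hn; set (x := INR (S n)) in *.
    destruct (sqr_sub_pos x t ltac:(lra) Ht).
    destruct (sqr_sub_pos (y + x) t ltac:(lra) Ht).
    assert (0 <= (x ^ 2 - t) / ((y + x) ^ 2 - t) <= 1).
    { split; [apply Rdiv_le_0_compat; lra|].
      apply Rmult_le_reg_r with ((y + x) ^ 2 - t); [lra|].
      unfold Rdiv; rewrite Rmult_assoc, Rinv_l by lra; nra. }
    split; [nra|].
    assert (0 <= 2 * / y ^ 2) by lra. nra.
Qed.

(** The array is [F n i = prod_ratio n t / cb n * ratio_kernel t n (i+1)].
    With [y = i + 1], the difference of rows [n] and [n+1] telescopes with
    [G = (2y/(n+1) + 3 - 2/(n+1)) / cb (n+1) * prod_ratio n t * ratio_kernel t n y],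
    and the linear factor equals 3 at [y = 1]. *)
Lemma is_series_even_zeta_gen (t : R) : 0 < t < 1 / 8 ->
  is_series (fun n => 3 * wt n * (prod_ratio n t * (INR (S n) ^ 2 / (INR (S n) ^ 2 - t))))
    (Series (fun i => 1 / (INR (S i) ^ 2 - t))).
Proof.
  intros Ht.
  set (F := fun n i => prod_ratio n t / cb n * ratio_kernel t n (INR (S i))).
  assert (HF : forall n i, Rabs (F n i) <= 2 / cb n * / INR (S i) ^ 2).
  { intros n i; unfold F.
    destruct (ratio_kernel_bounds t n (INR (S i)) Ht (INR_S_ge1 i)) as [K0 K1].
    assert (Hc : 0 < / cb n) by apply Rinv_0_lt_compat, cb_pos.
    unfold Rdiv; rewrite !Rabs_mult, (Rabs_pos_eq (/ cb n)), (Rabs_pos_eq (ratio_kernel _ _ _)) by lra.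
    pose proof (prod_ratio_le1 n t Ht); pose proof (Rabs_pos (prod_ratio n t)).
    replace (2 * / cb n * / INR (S i) ^ 2) with (1 * / cb n * (2 * / INR (S i) ^ 2)) by ring.
    apply Rmult_le_compat; try assumption; nra. }
  replace (Series _) with (Series (F 0%nat)).
  2:{ apply Series_ext; intros i; unfold F; rewrite cb_0; cbn [prod_ratio ratio_kernel]; field.
      destruct (sqr_sub_pos (INR (S i)) t (INR_S_ge1 i) Ht); lra. }
  apply is_series_wz with (c := 2); [exact HF|].
  intros n. rewrite <- Series_minus by (apply (ex_series_wz F 2 HF)).
  apply is_series_unique.
  set (q := fun y => 2 * y / INR (S n) + 3 - 2 / INR (S n)).
  set (G := fun i : nat => q (INR (S i)) / cb (S n) * prod_ratio n t * ratio_kernel t n (INR (S i))).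
  pose proof (cb_pos n) as Hcn; pose proof (pos_INR n) as Hn; pose proof (INR_S_ge1 n) as HSn.
  replace (3 * wt n * _) with (G 0%nat).
  2:{ unfold G, q, wt; simpl (INR 1); rewrite ratio_kernel_1 by assumption.
      pose proof (cb_pos (S n)).
      destruct (sqr_sub_pos (INR (S n)) t HSn Ht). field; lra. }
  apply is_series_ext with (fun i => G i - G (S i)).
  - intros i; unfold F, G, q; rewrite (S_INR (S i)).
    pose proof (INR_S_ge1 i) as Hi; set (y := INR (S i)) in *.
    rewrite ratio_kernel_shift by assumption; cbn [prod_ratio ratio_kernel].
    destruct (sqr_sub_pos (INR (S n)) t HSn Ht).
    destruct (sqr_sub_pos (y + INR (S n)) t ltac:(lra) Ht).
    clearbody y; rewrite cb_S; rewrite S_INR in *.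
    match goal with |- ?a = ?b => change (@eq R a b) end.
    field; repeat split; lra.
  - apply is_series_telescope.
    apply is_lim_seq_squeeze0 with (fun i => 10 / cb (S n) * / INR (S i)).
    + intros i; unfold G.
      pose proof (INR_S_ge1 i) as Hi; set (y := INR (S i)) in *.
      destruct (ratio_kernel_bounds t n y Ht Hi) as [K0 K1].
      assert (Hc : 0 < / cb (S n)) by apply Rinv_0_lt_compat, cb_pos.
      assert (Hq : 0 <= q y <= 5 * y).
      { unfold q.
        assert (0 < / INR (S n) <= 1).
        { split; [apply Rinv_0_lt_compat; lra|].
          rewrite <- Rinv_1; apply Rinv_le_contravar; lra. }
        unfold Rdiv; split; nra. }
      unfold Rdiv; rewrite !Rabs_mult, (Rabs_pos_eq (/ cb (S n))),
        (Rabs_pos_eq (q y)), (Rabs_pos_eq (ratio_kernel _ _ _)) by lra.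
      pose proof (prod_ratio_le1 n t Ht); pose proof (Rabs_pos (prod_ratio n t)).
      replace (10 * / cb (S n) * / y) with (5 * y * / cb (S n) * 1 * (2 * / y ^ 2))
        by (field; split; [lra|apply Rgt_not_eq, cb_pos]).
      repeat (apply Rmult_le_compat; try lra);
        repeat (apply Rmult_le_pos; try lra).
    + replace 0 with (10 / cb (S n) * 0) by ring.
      apply (is_lim_seq_scal_l _ _ 0), is_lim_seq_inv_S.
Qed.

(** * The generating function of the alternating zeta values *)

Fixpoint prod_sub (n : nat) (t : R) : R :=
  match n with
  | O => 1
  | S m => prod_sub m t * (1 - t / INR (S m) ^ 2)
  end.

Lemma prod_sub_factor_le1 (n : nat) (t : R) : 0 < t < 1 / 8 ->
  Rabs (1 - t / INR (S n) ^ 2) <= 1.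
Proof.
  intros Ht; pose proof (INR_S_ge1 n) as H; set (y := INR (S n)) in *.
  assert (0 < / y ^ 2 <= 1).
  { split; [apply Rinv_0_lt_compat, pow_lt; lra|].
    rewrite <- Rinv_1; apply Rinv_le_contravar; simpl; nra. }
  apply Rabs_le_between; unfold Rdiv; split; nra.
Qed.

Lemma prod_sub_le1 (n : nat) (t : R) : 0 < t < 1 / 8 -> Rabs (prod_sub n t) <= 1.
Proof.
  intros Ht; induction n as [|n IH]; [simpl; rewrite Rabs_R1; lra|].
  cbn [prod_sub]; rewrite Rabs_mult.
  pose proof (prod_sub_factor_le1 n t Ht).
  pose proof (Rabs_pos (prod_sub n t)).
  pose proof (Rabs_pos (1 - t / INR (S n) ^ 2)). nra.
Qed.

(** This is the Beta integral [B(m+1, i+1)]. *)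
Definition beta_int (m i : nat) : R := INR (fact m) * INR (fact i) / INR (fact (m + S i)).

Lemma beta_int_bounds (m i : nat) : 0 <= beta_int m i <= / INR (m + S i).
Proof.
  pose proof (INR_fact_lt_0 m) as Hm; pose proof (INR_fact_lt_0 i) as Hi.
  assert (Hle : forall j, INR (fact m) * INR (fact j) <= INR (fact (m + j))).
  { induction j as [|j IH].
    - rewrite Nat.add_0_r; simpl (fact 0); simpl; lra.
    - rewrite Nat.add_succ_r, !INR_fact_S.
      assert (INR (S j) <= INR (S (m + j))) by (apply le_INR; lia).
      pose proof (INR_S_pos j); pose proof (INR_fact_lt_0 (m + j)); nra. }
  unfold beta_int; rewrite Nat.add_succ_r, INR_fact_S.
  pose proof (INR_S_pos (m + i)) as HS; pose proof (INR_fact_lt_0 (m + i)) as Hf.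
  split.
  - apply Rdiv_le_0_compat; nra.
  - apply Rmult_le_reg_r with (INR (S (m + i)) * INR (fact (m + i))); [nra|].
    replace (/ _ * _) with (INR (fact (m + i))) by (field; lra).
    replace (_ / _ * _) with (INR (fact m) * INR (fact i)) by (field; lra).
    apply Hle.
Qed.

Lemma beta_int_SS (m i : nat) :
  beta_int (S (S m)) i * INR (S i) = beta_int m (S i) * (INR (S m) * INR (S (S m))) / INR (S (S (S (m + i)))).
Proof.
  unfold beta_int.
  replace (S (S m) + S i)%nat with (S (S (S (m + i)))) by lia.
  replace (m + S (S i))%nat with (S (S (m + i))) by lia.
  rewrite !INR_fact_S.
  pose proof (INR_S_pos (m + i)); pose proof (INR_S_pos (S (m + i))).
  pose proof (INR_S_pos (S (S (m + i)))); pose proof (INR_fact_lt_0 (m + i)).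
  field; repeat split; lra.
Qed.

Lemma beta_int_S_r (m i : nat) :
  beta_int m (S i) * INR (S (S (m + i))) = beta_int m i * INR (S i).
Proof.
  unfold beta_int.
  replace (m + S i)%nat with (S (m + i)) by lia.
  replace (m + S (S i))%nat with (S (S (m + i))) by lia.
  rewrite !INR_fact_S.
  pose proof (INR_S_pos (m + i)); pose proof (INR_S_pos (S (m + i))).
  pose proof (INR_fact_lt_0 (m + i)).
  field; repeat split; lra.
Qed.

(** With [J = n + 1 + i], the array is, up to the factor 2,
    [(-1)^i J (J-n-1)!/((J+n)! (J^2-t)) prod_(m<=n) (m^2-t)].  For a fixed [J]
    all rows have the same residue at [t = J^2], so the pole cancels in the
    difference of rows [n-1] and [n]; what is left is a multiple of
    [(-1)^J J (J-n-1)!/(J+n)!], which telescopes in [J].  Row [n+1] starts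
    one step later in [J] than row [n], so the first term of row [n] is split off. *)
Lemma is_series_alternating_zeta_gen (t : R) : 0 < t < 1 / 8 ->
  is_series
    (fun n => wt n * (prod_sub n t * ((3 * INR (S n) ^ 2 + t) / (INR (S n) ^ 2 - t))))
    (2 * Series (fun i => (-1) ^ i / (INR (S i) ^ 2 - t))).
Proof.
  intros Ht.
  set (F := fun n i => 2 * ((-1) ^ i * (prod_sub n t / cb n)
     * (beta_int (2 * n) i * (INR (S (n + i)) / (INR (S (n + i)) ^ 2 - t))))).
  assert (HF : forall n i, Rabs (F n i) <= 4 / cb n * / INR (S i) ^ 2).
  { intros n i; unfold F.
    assert (Hc : 0 < / cb n) by apply Rinv_0_lt_compat, cb_pos.
    destruct (beta_int_bounds (2 * n) i) as [B0 B1].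
    pose proof (INR_S_ge1 (n + i)) as HJ; pose proof (INR_S_ge1 i) as Hi.
    assert (HiJ : INR (S i) <= INR (S (n + i))) by (apply le_INR; lia).
    assert (HJ2 : INR (S (n + i)) <= INR (2 * n + S i)) by (apply le_INR; lia).
    set (J := INR (S (n + i))) in *; set (y := INR (S i)) in *.
    destruct (sqr_sub_pos J t HJ Ht).
    assert (HB : 0 <= beta_int (2 * n) i * (J / (J ^ 2 - t)) <= 2 * / y ^ 2).
    { assert (HQ : 0 <= J / (J ^ 2 - t)) by (apply Rdiv_le_0_compat; lra).
      split; [nra|].
      apply Rle_trans with (/ J * (J / (J ^ 2 - t))).
      - apply Rmult_le_compat_r; [assumption|].
        apply Rle_trans with (1 := B1); apply Rinv_le_contravar; lra.
      - replace (/ J * _) with (/ (J ^ 2 - t)) by (field; lra).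
        replace (2 * / y ^ 2) with (/ (y ^ 2 / 2)) by (field; lra).
        apply Rinv_le_contravar; [simpl; nra|].
        assert (y ^ 2 <= J ^ 2) by (apply pow_incr; lra). lra. }
    pose proof (prod_sub_le1 n t Ht); pose proof (Rabs_pos (prod_sub n t)).
    unfold Rdiv at 1; rewrite !Rabs_mult, pow_1_abs, (Rabs_pos_eq 2), (Rabs_pos_eq (/ cb n)) by lra.
    rewrite <- (Rabs_mult (beta_int _ _)), (Rabs_pos_eq (_ * _)) by lra.
    replace (4 / cb n * / y ^ 2) with (2 * (1 * (1 * / cb n) * (2 * / y ^ 2)))
      by (unfold Rdiv; ring).
    apply Rmult_le_compat_l; [lra|].
    apply Rmult_le_compat; try lra; nra. }
  rewrite <- Series_scal_l.
  replace (Series _) with (Series (F 0%nat)).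
  2:{ apply Series_ext; intros i; unfold F.
      rewrite cb_0; cbn [prod_sub]; unfold beta_int.
      rewrite Nat.mul_0_r, !Nat.add_0_l, INR_fact_S; simpl (fact 0); simpl (INR 1).
      destruct (sqr_sub_pos (INR (S i)) t (INR_S_ge1 i) Ht).
      pose proof (INR_S_pos i); pose proof (INR_fact_lt_0 i). field; lra. }
  apply is_series_wz with (c := 4); [exact HF|].
  pose proof (ex_series_wz F 4 HF) as HexF.
  intros n. rewrite (Series_incr_1 (F n)) by apply HexF.
  pose proof (cb_pos n) as Hcn; pose proof (pos_INR n) as Hn; pose proof (INR_S_ge1 n) as HSn.
  (* after the first term is split off, both rows are indexed by the same J *)
  set (G := fun i : nat => - ((-1) ^ i * (prod_sub n t / cb n)
     * (beta_int (2 * n) i / INR (S (S (2 * n + i)))))).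
  assert (HG : Series (fun i => F n (S i)) - Series (F (S n)) = G 0%nat).
  { rewrite <- Series_minus;
      [|apply (ex_series_incr_1 (F n)), HexF|apply HexF].
    apply is_series_unique.
    apply is_series_ext with (fun i => G i - G (S i)).
    - intros i; unfold F, G.
      pose proof (beta_int_SS (2 * n) i) as E1; pose proof (beta_int_S_r (2 * n) i) as E2.
      replace (2 * S n)%nat with (S (S (2 * n))) by lia.
      replace (2 * n + S i)%nat with (S (2 * n + i)) by lia.
      replace (S n + i)%nat with (S (n + i)) by lia.
      replace (n + S i)%nat with (S (n + i)) by lia.
      rewrite cb_S; cbn [prod_sub pow].
      rewrite !S_INR in *; rewrite !plus_INR, !mult_INR in *; simpl (INR 2) in *.
      pose proof (pos_INR i) as Hi.
      set (x := INR n) in *; set (z := INR i) in *.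
      assert (Hb0 : beta_int (2 * n) i = beta_int (2 * n) (S i) * (2 * x + z + 2) / (z + 1)).
      { apply Rmult_eq_reg_r with (z + 1); [|lra].
        rewrite <- E2; field; lra. }
      assert (Hb1 : beta_int (S (S (2 * n))) i = beta_int (2 * n) (S i)
        * ((2 * x + 1) * (2 * x + 2)) / ((2 * x + z + 3) * (z + 1))).
      { apply Rmult_eq_reg_r with (z + 1); [|lra].
        rewrite E1; field; repeat split; lra. }
      rewrite Hb0, Hb1.
      destruct (sqr_sub_pos (x + z + 1 + 1) t ltac:(lra) Ht).
      match goal with |- ?a = ?b => change (@eq R a b) end.
      field; repeat split; try lra.
    - apply is_series_telescope.
      apply is_lim_seq_squeeze0 with (fun i => / cb n * / INR (S i)).
      + intros i; unfold G.
        destruct (beta_int_bounds (2 * n) i) as [B0 B1].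
        assert (Hc : 0 < / cb n) by apply Rinv_0_lt_compat, cb_pos.
        pose proof (prod_sub_le1 n t Ht); pose proof (Rabs_pos (prod_sub n t)).
        assert (B2 : / INR (2 * n + S i) <= / INR (S i)).
        { apply Rinv_le_contravar; [apply INR_S_pos|apply le_INR; lia]. }
        assert (B3 : 0 < / INR (S (S (2 * n + i))) <= 1).
        { split; [apply Rinv_0_lt_compat, INR_S_pos|].
          rewrite <- Rinv_1; apply Rinv_le_contravar; [lra|apply INR_S_ge1]. }
        unfold Rdiv; rewrite Rabs_Ropp, !Rabs_mult, pow_1_abs, (Rabs_pos_eq (/ cb n)),
          (Rabs_pos_eq (beta_int _ _)), (Rabs_pos_eq (/ INR _)) by lra.
        apply Rmult_le_compat; nra.
      + replace 0 with (/ cb n * 0) by ring.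
        apply (is_lim_seq_scal_l _ _ 0), is_lim_seq_inv_S. }
  match goal with |- ?a + ?b - ?c = _ => replace (a + b - c) with (a + (b - c)) by ring end.
  rewrite HG; unfold F, G, wt.
  assert (Hb : beta_int (2 * n) 0 = / (2 * INR n + 1)).
  { unfold beta_int; replace (2 * n + 1)%nat with (S (2 * n)) by lia.
    rewrite INR_fact_S, S_INR, mult_INR; simpl (INR 2); simpl (fact 0); simpl (INR 1).
    pose proof (INR_fact_lt_0 (2 * n)); field; lra. }
  rewrite Hb, !Nat.add_0_r, cb_S; cbn [pow].
  rewrite !S_INR in *; rewrite !mult_INR; simpl (INR 2).
  destruct (sqr_sub_pos (INR n + 1) t ltac:(lra) Ht).
  field; repeat split; lra.
Qed.

(** * Comparison of the coefficients of t^2 *)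

Lemma ex_series_wt (u : nat -> R) (K : R) :
  (forall n, Rabs (u n) <= K * (INR n + 1)) -> ex_series (fun n => wt n * u n).
Proof.
  intros Hu.
  apply ex_series_Rabs_le with (fun n => K * (2 / 3) ^ n).
  - intros n.
    assert (H2 : INR n + 1 <= 2 ^ n).
    { induction n as [|n IH]; [simpl; lra|].
      rewrite S_INR; simpl (2 ^ S n); pose proof (pos_INR n); lra. }
    pose proof (wt_pos n) as Hw; pose proof (wt_le n) as Hw'.
    rewrite Rabs_mult, (Rabs_pos_eq (wt n)) by lra.
    assert (HK : 0 <= K).
    { pose proof (Hu n); pose proof (Rabs_pos (u n)); pose proof (pos_INR n); nra. }
    replace (K * (2 / 3) ^ n) with ((/ 3) ^ n * (K * 2 ^ n))
      by (unfold Rdiv; rewrite Rpow_mult_distr; ring).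
    apply Rmult_le_compat; [lra|apply Rabs_pos|exact Hw'|].
    apply Rle_trans with (1 := Hu n), Rmult_le_compat_l; assumption.
  - apply (ex_series_scal_l K (fun n => (2 / 3) ^ n)).
    apply ex_series_geom; rewrite Rabs_pos_eq; lra.
Qed.

Lemma inv_pow_INR_S (n k : nat) : 0 < / INR (S n) ^ k <= 1.
Proof.
  pose proof (INR_S_ge1 n) as H; split.
  - apply Rinv_0_lt_compat, pow_lt; lra.
  - rewrite <- Rinv_1; apply Rinv_le_contravar; [lra|apply pow_R1_Rle; lra].
Qed.

Lemma inv_sqr_sub_le (n : nat) (t : R) : 0 < t < 1 / 8 ->
  0 < / (INR (S n) ^ 2 - t) <= 2.
Proof.
  intros Ht; destruct (sqr_sub_pos _ t (INR_S_ge1 n) Ht); split.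
  - apply Rinv_0_lt_compat; lra.
  - apply Rle_trans with (/ (1 / 2)); [apply Rinv_le_contravar; lra|right; field].
Qed.

Lemma jet_inv_sqr_sub (n : nat) :
  jet (2 / INR (S n) ^ 2) (fun t => / (INR (S n) ^ 2 - t))
    (/ INR (S n) ^ 2) (/ INR (S n) ^ 4) (/ INR (S n) ^ 6).
Proof.
  intros t Ht; pose proof (INR_S_ge1 n) as Hy.
  pose proof (inv_pow_INR_S n 6) as H6.
  set (y := INR (S n)) in *.
  destruct (sqr_sub_pos y t Hy Ht) as [H1 H2].
  replace (_ - _) with (/ y ^ 6 * / (y ^ 2 - t) * t ^ 3) by (field; split; lra).
  assert (H3 : 0 < / (y ^ 2 - t)) by (apply Rinv_0_lt_compat; lra).
  assert (H4 : / (y ^ 2 - t) <= 2 / y ^ 2).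
  { replace (2 / y ^ 2) with (/ (y ^ 2 / 2)) by (field; lra).
    apply Rinv_le_contravar; [simpl; nra|lra]. }
  assert (Ht3 : 0 < t ^ 3) by (apply pow_lt; lra).
  rewrite Rabs_pos_eq.
  - apply Rmult_le_compat_r; [lra|]. nra.
  - apply Rmult_le_pos; [apply Rmult_le_pos|]; lra.
Qed.

Lemma jet_add_pole (n : nat) (p q : R) :
  jet (2 * Rabs q) (fun t => p + q * t * / (INR (S n) ^ 2 - t))
    p (q * / INR (S n) ^ 2) (q * / INR (S n) ^ 4).
Proof.
  intros t Ht; pose proof (INR_S_ge1 n) as Hy.
  pose proof (inv_pow_INR_S n 4) as H4.
  set (y := INR (S n)) in *.
  destruct (sqr_sub_pos y t Hy Ht) as [H1 H2].
  replace (_ - _) with (q * (/ y ^ 4 * / (y ^ 2 - t)) * t ^ 3) by (field; split; lra).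
  pose proof (inv_sqr_sub_le n t Ht) as H3; fold y in H3.
  assert (Ht3 : 0 < t ^ 3) by (apply pow_lt; lra).
  assert (H5 : 0 <= / y ^ 4 * / (y ^ 2 - t) <= 2) by (split; nra).
  rewrite !Rabs_mult, (Rabs_pos_eq (t ^ 3)), <- Rabs_mult, (Rabs_pos_eq (_ * _)) by lra.
  apply Rmult_le_compat_r; [lra|].
  pose proof (Rabs_pos q); nra.
Qed.

Lemma esym_abs (n j : nat) : Rabs (esym n j) <= 2 ^ j.
Proof. rewrite Rabs_pos_eq by apply esym_nonneg; apply esym_le. Qed.

Lemma jet_prod_sub (n : nat) :
  jet (12 * INR n) (prod_sub n) 1 (- esym n 1) (esym n 2).
Proof.
  induction n as [|n IH].
  - intros t Ht; simpl. rewrite Rabs_pos_eq; lra.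
  - pose proof (inv_pow_INR_S n 2) as H2.
    assert (Hf : jet 0 (fun t => 1 - t / INR (S n) ^ 2) 1 (- / INR (S n) ^ 2) 0).
    { intros t Ht. replace (_ - _) with 0 by (unfold Rdiv; ring). rewrite Rabs_R0; lra. }
    pose proof (esym_abs n 1); pose proof (esym_abs n 2).
    eapply jet_ext; [apply (jet_mult _ _ 4 1 1 _ _ _ _ _ _ _ _ IH Hf)| | | | |].
    + apply prod_sub_factor_le1.
    + rewrite Rabs_R1; lra.
    + rewrite Rabs_Ropp; lra.
    + lra.
    + rewrite Rabs_Ropp, Rabs_pos_eq; lra.
    + rewrite Rabs_R0; lra.
    + rewrite S_INR; lra.
    + reflexivity.
    + ring.
    + rewrite esym_S, esym_0; unfold Rdiv; ring.
    + rewrite (esym_S n 1); unfold Rdiv; ring.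
Qed.

Lemma S4_abs (n : nat) : Rabs (S4 n) <= 2.
Proof.
  pose proof (S4_bounds n); pose proof (esym_1_le n); rewrite Rabs_pos_eq; lra.
Qed.

Lemma prod_ratio_coeff_le (n : nat) : Rabs (9 * esym n 2 - 3 * S4 n) <= 42.
Proof.
  pose proof (esym_abs n 2) as H1; pose proof (S4_abs n) as H2.
  apply Rabs_le_between in H1; apply Rabs_le_between in H2.
  apply Rabs_le_between; split; lra.
Qed.

(** Each factor is [1 - 3t/(m^2-t) = 1 - 3t/m^2 - 3t^2/m^4 + O(t^3)], with
    logarithm [-3t/m^2 - (15/2)t^2/m^4 + O(t^3)]; the power sum of order 4 that
    enters here is where [S4] comes from. *)
Lemma jet_prod_ratio (n : nat) :
  jet (1134 * INR n) (prod_ratio n) 1 (- (3 * esym n 1)) (9 * esym n 2 - 3 * S4 n).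
Proof.
  induction n as [|n IH].
  - intros t Ht; rewrite S4_0; simpl. rewrite Rabs_pos_eq; lra.
  - pose proof (inv_pow_INR_S n 2) as H2; pose proof (inv_pow_INR_S n 4) as H4.
    pose proof (esym_abs n 1) as He; pose proof (prod_ratio_coeff_le n).
    eapply jet_ext;
      [apply (jet_mult _ _ 42 3 1 _ _ _ _ _ _ _ _ IH (jet_add_pole n 1 (-3)))| | | | |].
    + intros t Ht; destruct (sqr_sub_pos _ t (INR_S_ge1 n) Ht).
      replace (1 + _) with ((INR (S n) ^ 2 - 4 * t) / (INR (S n) ^ 2 - t)) by (field; lra).
      apply prod_ratio_factor_le1, Ht.
    + rewrite Rabs_R1; lra.
    + rewrite Rabs_Ropp, Rabs_mult, (Rabs_pos_eq 3) by lra; lra.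
    + assumption.
    + apply Rabs_le_between; lra.
    + apply Rabs_le_between; lra.
    + rewrite (Rabs_left (-3)), S_INR by lra; lra.
    + intros t Ht; destruct (sqr_sub_pos _ t (INR_S_ge1 n) Ht).
      cbn [prod_ratio]; field; lra.
    + ring.
    + rewrite esym_S, esym_0; unfold Rdiv; ring.
    + rewrite (esym_S n 1), S4_S; unfold Rdiv; ring.
Qed.

Lemma jet_series_inv_sqr_sub (s : nat -> R) : (forall i, Rabs (s i) <= 1) ->
  exists M a b, jet M (fun t => Series (fun i => s i / (INR (S i) ^ 2 - t)))
    a b (Series (fun i => s i / INR (S i) ^ 6)).
Proof.
  intros Hs.
  assert (H2 : ex_series (fun i => 2 * / INR (S i) ^ 2))
    by apply (ex_series_scal_l 2 (fun i => / INR (S i) ^ 2)), ex_series_inv_sqr.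
  assert (Hex : forall k, ex_series (fun i => s i / INR (S i) ^ (2 + k))).
  { intros k; apply ex_series_Rabs_le with (2 := ex_series_inv_sqr).
    intros i; unfold Rdiv; rewrite Rabs_mult.
    pose proof (inv_pow_INR_S i (2 + k)) as H1.
    rewrite (Rabs_pos_eq (/ _)) by lra.
    apply Rle_trans with (1 * / INR (S i) ^ (2 + k));
      [apply Rmult_le_compat_r; [lra|apply Hs]|rewrite Rmult_1_l].
    apply Rinv_le_contravar; [apply pow_lt, INR_S_pos|].
    apply Rle_pow; [apply INR_S_ge1|lia]. }
  do 3 eexists.
  apply (jet_series (fun i => 2 * / INR (S i) ^ 2) (fun i => s i / INR (S i) ^ 2)
    (fun i => s i / INR (S i) ^ 4) (fun i => s i / INR (S i) ^ 6)
    (fun i t => s i / (INR (S i) ^ 2 - t))).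
  - intros i; eapply jet_ext; [apply (jet_scal (s i)), jet_inv_sqr_sub| | | | |];
      try reflexivity.
    pose proof (inv_pow_INR_S i 2); pose proof (Hs i); unfold Rdiv; nra.
  - exact H2.
  - apply (Hex 0%nat).
  - apply (Hex 2%nat).
  - apply (Hex 4%nat).
  - intros t Ht; apply Series_correct, ex_series_Rabs_le with (2 := H2).
    intros i; unfold Rdiv; rewrite Rabs_mult.
    destruct (ratio_kernel_bounds t 0 (INR (S i)) Ht (INR_S_ge1 i)) as [K0 K1].
    cbn [ratio_kernel] in K0, K1. rewrite (Rabs_pos_eq (/ _)) by exact K0.
    pose proof (Hs i); nra.
Qed.

Lemma is_series_alternating_coeff2 :
  is_series (fun n => wt n * (4 / INR (S n) ^ 4 - 4 * esym n 1 / INR (S n) ^ 2 + 3 * esym n 2))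
    (2 * Series (fun i => (-1) ^ i / INR (S i) ^ 6)).
Proof.
  set (f := fun n t => wt n * (prod_sub n t * ((3 * INR (S n) ^ 2 + t) / (INR (S n) ^ 2 - t)))).
  set (a := fun n : nat => wt n * 3).
  set (b := fun n => wt n * (4 / INR (S n) ^ 2 - 3 * esym n 1)).
  set (c := fun n => wt n * (4 / INR (S n) ^ 4 - 4 * esym n 1 / INR (S n) ^ 2 + 3 * esym n 2)).
  set (M := fun n => wt n * (48 * INR n + 144)).
  assert (Hf : forall n, jet (M n) (f n) (a n) (b n) (c n)).
  { intros n.
    pose proof (inv_pow_INR_S n 2) as H2; pose proof (inv_pow_INR_S n 4) as H4.
    pose proof (esym_abs n 1); pose proof (esym_abs n 2); pose proof (wt_pos n).
    eapply jet_ext; [apply (jet_scal (wt n)),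
      (jet_mult _ _ 4 4 4 _ _ _ _ _ _ _ _ (jet_prod_sub n) (jet_add_pole n 3 4))| | | | |].
    - intros t Ht; pose proof (inv_sqr_sub_le n t Ht).
      apply Rabs_le_between; split; nra.
    - rewrite Rabs_R1; lra.
    - rewrite Rabs_Ropp; lra.
    - lra.
    - apply Rabs_le_between; lra.
    - apply Rabs_le_between; lra.
    - rewrite (Rabs_pos_eq (wt n)), (Rabs_pos_eq 4) by lra; unfold M.
      apply Rmult_le_compat_l; lra.
    - intros t Ht; destruct (sqr_sub_pos _ t (INR_S_ge1 n) Ht).
      unfold f; field; lra.
    - unfold a; ring.
    - unfold b, Rdiv; ring.
    - unfold c, Rdiv; ring. }
  assert (HM : ex_series M).
  { apply (ex_series_wt _ 144); intros n; pose proof (pos_INR n).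
    rewrite Rabs_pos_eq; lra. }
  assert (Hbd : forall n, Rabs (4 / INR (S n) ^ 2 - 3 * esym n 1) <= 144 * (INR n + 1)
    /\ Rabs (4 / INR (S n) ^ 4 - 4 * esym n 1 / INR (S n) ^ 2 + 3 * esym n 2)
       <= 144 * (INR n + 1)).
  { intros n; pose proof (pos_INR n).
    pose proof (inv_pow_INR_S n 2) as H2; pose proof (inv_pow_INR_S n 4) as H4.
    pose proof (esym_nonneg n 1); pose proof (esym_nonneg n 2).
    pose proof (esym_le n 1); pose proof (esym_le n 2).
    unfold Rdiv; split; apply Rabs_le_between; split; nra. }
  assert (Ha : ex_series a).
  { apply (ex_series_wt _ 3); intros n; pose proof (pos_INR n); rewrite Rabs_pos_eq; lra. }
  assert (Hb : ex_series b) by (apply (ex_series_wt _ 144); apply Hbd).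
  assert (Hc : ex_series c) by (apply (ex_series_wt _ 144); apply Hbd).
  pose proof (jet_series M a b c f _ Hf HM Ha Hb Hc is_series_alternating_zeta_gen) as J1.
  destruct (jet_series_inv_sqr_sub (fun i => (-1) ^ i)) as (M' & a' & b' & J2).
  { intros i; rewrite pow_1_abs; lra. }
  apply (jet_scal 2) in J2.
  rewrite <- (jet_unique _ _ _ _ _ _ _ _ _ J1 J2).
  apply Series_correct, Hc.
Qed.

Lemma is_series_even_coeff2 :
  is_series (fun n => 3 * wt n *
      (/ INR (S n) ^ 4 - 3 * esym n 1 / INR (S n) ^ 2 + (9 * esym n 2 - 3 * S4 n)))
    (Series (fun i => 1 / INR (S i) ^ 6)).
Proof.
  set (f := fun n t => 3 * wt n * (prod_ratio n t * (INR (S n) ^ 2 / (INR (S n) ^ 2 - t)))).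
  set (ub := fun n => / INR (S n) ^ 2 - 3 * esym n 1).
  set (uc := fun n => / INR (S n) ^ 4 - 3 * esym n 1 / INR (S n) ^ 2
    + (9 * esym n 2 - 3 * S4 n)).
  set (uM := fun n => 2268 * INR n + 378).
  assert (Hf : forall n, jet (3 * wt n * uM n) (f n) (3 * wt n * 1) (3 * wt n * ub n)
    (3 * wt n * uc n)).
  { intros n.
    pose proof (inv_pow_INR_S n 2) as H2; pose proof (inv_pow_INR_S n 4) as H4.
    pose proof (esym_abs n 1); pose proof (prod_ratio_coeff_le n); pose proof (wt_pos n).
    eapply jet_ext; [apply (jet_scal (3 * wt n)),
      (jet_mult _ _ 42 1 2 _ _ _ _ _ _ _ _ (jet_prod_ratio n) (jet_add_pole n 1 1))| | | | |].
    - intros t Ht; pose proof (inv_sqr_sub_le n t Ht).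
      apply Rabs_le_between; split; nra.
    - rewrite Rabs_R1; lra.
    - rewrite Rabs_Ropp, Rabs_mult, (Rabs_pos_eq 3) by lra; lra.
    - assumption.
    - apply Rabs_le_between; lra.
    - apply Rabs_le_between; lra.
    - rewrite (Rabs_pos_eq (3 * wt n)), (Rabs_pos_eq 1) by lra; unfold uM.
      apply Rmult_le_compat_l; lra.
    - intros t Ht; destruct (sqr_sub_pos _ t (INR_S_ge1 n) Ht).
      unfold f; field; lra.
    - ring.
    - unfold ub, Rdiv; ring.
    - unfold uc, Rdiv; ring. }
  assert (Hex : forall u, (forall n, Rabs (u n) <= 2268 * (INR n + 1)) ->
    ex_series (fun n => 3 * wt n * u n)).
  { intros u Hu; apply ex_series_ext with (fun n => 3 * (wt n * u n)).
    - intros n; symmetry; apply Rmult_assoc.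
    - apply (ex_series_scal_l 3 (fun n => wt n * u n)), (ex_series_wt u 2268 Hu). }
  assert (Hc : ex_series (fun n => 3 * wt n * uc n)).
  { apply Hex; intros n; pose proof (pos_INR n).
    pose proof (inv_pow_INR_S n 2); pose proof (inv_pow_INR_S n 4).
    pose proof (esym_nonneg n 1); pose proof (esym_le n 1).
    pose proof (prod_ratio_coeff_le n) as HB; apply Rabs_le_between in HB.
    unfold uc, Rdiv; apply Rabs_le_between; split; nra. }
  assert (HM : ex_series (fun n => 3 * wt n * uM n)).
  { apply Hex; intros n; pose proof (pos_INR n).
    unfold uM; rewrite Rabs_pos_eq; lra. }
  assert (Ha : ex_series (fun n => 3 * wt n * 1)).
  { apply Hex; intros n; pose proof (pos_INR n); rewrite Rabs_R1; lra. }
  assert (Hb : ex_series (fun n => 3 * wt n * ub n)).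
  { apply Hex; intros n; pose proof (pos_INR n).
    pose proof (inv_pow_INR_S n 2).
    pose proof (esym_nonneg n 1); pose proof (esym_le n 1).
    unfold ub; apply Rabs_le_between; split; lra. }
  pose proof (jet_series _ _ _ _ f _ Hf HM Ha Hb Hc is_series_even_zeta_gen) as J1.
  destruct (jet_series_inv_sqr_sub (fun _ => 1)) as (M' & a' & b' & J2).
  { intros _; rewrite Rabs_R1; lra. }
  rewrite <- (jet_unique _ _ _ _ _ _ _ _ _ J1 J2).
  apply Series_correct, Hc.
Qed.

(** * The series for the sixth power of the arcsine *)

(** The squared length of the chord of the unit circle of angle [x], that is
    [(2 sin (x/2))^2]. *)
Definition chord2 (x : R) : R := 2 - 2 * cos x.

(** For [j >= 1] a partial sum of a series for [x^(2j) / (2j)!] in powers of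
    [chord2 x]; the index is shifted by one so that the second derivative of
    the sum of index [j+1] is the sum of index [j], up to a small remainder. *)
Definition arcsum (N j : nat) (x : R) : R :=
  match j with
  | O => 1
  | S i => sum_n (fun n => wt n * esym n i * chord2 x ^ S n) N
  end.

Definition arcsum' (N i : nat) (x : R) : R :=
  sum_n (fun n => wt n * esym n i * (INR (S n) * chord2 x ^ n * (2 * sin x))) N.

Lemma sum_n_zero (u : nat -> R) (N : nat) : (forall n, u n = 0) -> sum_n u N = 0.
Proof.
  intros H; induction N as [|N IH]; [rewrite sum_O; apply H|].
  rewrite sum_Sn, IH, H; apply Rplus_0_l.
Qed.

Lemma is_derive_sum_n (f f' : nat -> R -> R) (x : R) (N : nat) :
  (forall n, is_derive (f n) x (f' n x)) ->
  is_derive (fun y => sum_n (fun n => f n y) N) x (sum_n (fun n => f' n x) N).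
Proof.
  intros H; induction N as [|N IH].
  - apply is_derive_ext with (f 0%nat); [intros y; rewrite sum_O; reflexivity|].
    rewrite sum_O; apply H.
  - apply is_derive_ext with (fun y => plus (sum_n (fun n => f n y) N) (f (S N) y));
      [intros y; rewrite sum_Sn; reflexivity|].
    rewrite sum_Sn; apply (is_derive_plus (fun y => sum_n (fun n => f n y) N));
      [exact IH|apply H].
Qed.

Lemma is_derive_arcsum (N i : nat) (x : R) :
  is_derive (arcsum N (S i)) x (arcsum' N i x).
Proof.
  apply (is_derive_sum_n (fun n y => wt n * esym n i * chord2 y ^ S n)
    (fun n y => wt n * esym n i * (INR (S n) * chord2 y ^ n * (2 * sin y)))).
  intros n; unfold chord2; auto_derive; [exact I|].
  change (match n with O => 1 | S _ => INR n + 1 end) with (INR (S n)).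
  change (2 + - (2 * cos x)) with (2 - 2 * cos x); ring.
Qed.

Lemma chord2_pow_deriv2 (n : nat) (x : R) :
  is_derive (fun y => INR (S n) * chord2 y ^ n * (2 * sin y)) x
    (INR (S n) * (4 * INR n + 2) * chord2 x ^ n - INR (S n) ^ 2 * chord2 x ^ S n).
Proof.
  assert (Hs : 4 * sin x ^ 2 = chord2 x * (4 - chord2 x)).
  { pose proof (sin2_cos2 x) as E; unfold Rsqr in E; unfold chord2; simpl; nra. }
  destruct n as [|n].
  - unfold chord2; auto_derive; [exact I|]. simpl; ring.
  - assert (Hz : INR (S (S n)) = INR (S n) + 1) by apply S_INR.
    set (z := INR (S (S n))) in *; clearbody z.
    unfold chord2 in *; auto_derive; [exact I|].
    change (match n with O => 1 | S _ => INR n + 1 end) with (INR (S n)).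
    change (2 + - (2 * cos x)) with (2 - 2 * cos x).
    transitivity (z * (2 - 2 * cos x) ^ n
      * (INR (S n) * (4 * sin x ^ 2) + 2 * cos x * (2 - 2 * cos x)));
      [simpl (_ ^ 2); ring|].
    rewrite Hs, Hz; set (m := INR (S n)); simpl; ring.
Qed.

(** Summation by parts: [w_k k (4k-2) = 1/cb (k-1)] shifts the first part of each
    term by one, and [esym k (S h) - esym (k-1) (S h) = esym (k-1) h / k^2]
    turns the differences into the sum of lower index.  Only the last term of the
    telescoping part survives. *)
Lemma sum_n_chord2_deriv2 (N i : nat) (v : R) :
  sum_n (fun n => wt n * esym n i
      * (INR (S n) * (4 * INR n + 2) * v ^ n - INR (S n) ^ 2 * v ^ S n)) N
  = match i with
    | O => 1
    | S h => sum_n (fun n => wt n * esym n h * v ^ S n) N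
    end - esym (S N) i * v ^ S N / cb (S N).
Proof.
  induction N as [|N IH].
  - rewrite !sum_O; unfold wt; rewrite cb_S, cb_0.
    destruct i as [|h]; [simpl; field|].
    rewrite sum_O; unfold wt; rewrite cb_S, cb_0.
    destruct h; simpl; field.
  - rewrite !sum_Sn, IH; unfold plus; cbn -[INR pow cb esym sum_n].
    pose proof (cb_pos (S N)) as Hc; pose proof (pos_INR N).
    unfold wt; destruct i as [|h].
    + rewrite !esym_0, (cb_S (S N)), !S_INR; simpl (v ^ S (S N)); simpl (v ^ S N).
      field; repeat split; lra.
    + rewrite sum_Sn, (esym_S (S N)); unfold plus; cbn -[INR pow cb esym sum_n].
      unfold wt; rewrite (cb_S (S N)), !S_INR; simpl (v ^ S (S N)); simpl (v ^ S N).
      field; repeat split; lra.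
Qed.

Lemma is_derive_arcsum' (N i : nat) (x : R) :
  is_derive (arcsum' N i) x
    (arcsum N i x - esym (S N) i * chord2 x ^ S N / cb (S N)).
Proof.
  pose proof (sum_n_chord2_deriv2 N i (chord2 x)) as E.
  replace (arcsum N i x - _) with (sum_n (fun n => wt n * esym n i
      * (INR (S n) * (4 * INR n + 2) * chord2 x ^ n - INR (S n) ^ 2 * chord2 x ^ S n)) N)
    by (rewrite E; destruct i; reflexivity).
  apply (is_derive_sum_n
    (fun n y => wt n * esym n i * (INR (S n) * chord2 y ^ n * (2 * sin y)))
    (fun n y => wt n * esym n i *
       (INR (S n) * (4 * INR n + 2) * chord2 y ^ n - INR (S n) ^ 2 * chord2 y ^ S n))).
  intros n.
  apply (is_derive_scal (fun y => INR (S n) * chord2 y ^ n * (2 * sin y))).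
  apply chord2_pow_deriv2.
Qed.

Lemma abs_le_of_derive (g dg : R -> R) (a e : R) :
  (forall x, is_derive g x (dg x)) -> g 0 = 0 ->
  (forall x, 0 <= x <= a -> Rabs (dg x) <= e) ->
  forall x, 0 <= x <= a -> Rabs (g x) <= e * x.
Proof.
  intros Hd H0 He x Hx.
  destruct (MVT_gen g 0 x dg) as (c & Hc & E).
  - intros y _; apply Hd.
  - intros y _; apply derivable_continuous_pt.
    exists (dg y); apply is_derive_Reals, Hd.
  - rewrite Rmin_left, Rmax_right in Hc by lra.
    rewrite H0, !Rminus_0_r in E; rewrite E, Rabs_mult, (Rabs_pos_eq x) by lra.
    apply Rmult_le_compat_r; [lra|apply He; lra].
Qed.

(** Both sides vanish at 0 together with their first derivatives when [j >= 1],
    and the second derivative of their difference is the difference of index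
    [j-1] up to [4 / cb (S N)], because there [chord2 <= 1] and
    the value of [esym] that occurs is at most 4.  Integrating
    twice multiplies the bound by at most [(4/3)^2 <= 2]. *)
Lemma arcsum_error (N j : nat) (x : R) : (j <= 3)%nat -> 0 <= x <= PI / 3 ->
  Rabs (x ^ (2 * j) / INR (fact (2 * j)) - arcsum N j x)
    <= (2 ^ S j - 2) * (4 / cb (S N)).
Proof.
  revert x; induction j as [|j IH]; intros x Hj Hx.
  - simpl; replace (1 / 1 - 1) with 0 by field; rewrite Rabs_R0; lra.
  - set (e := 4 / cb (S N)) in *.
    assert (He : 0 < e) by (apply Rdiv_lt_0_compat; [lra|apply cb_pos]).
    pose proof PI_4 as HPI.
    set (E := 2 ^ S j - 2) in *.
    assert (HE : 0 <= E) by (unfold E; pose proof (pow_R1_Rle 2 j ltac:(lra)); simpl; lra).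
    set (f := fun k y => y ^ k / INR (fact k)).
    assert (Hf : forall k y, is_derive (f (S k)) y (f k y)).
    { intros k y; unfold f.
      pose proof (INR_fact_S k) as HF; pose proof (INR_fact_lt_0 k) as Hk.
      pose proof (INR_S_pos k) as HS.
      set (F := INR (fact (S k))) in *; set (F0 := INR (fact k)) in *.
      assert (HF' : F <> 0) by nra.
      replace (y ^ k / F0) with (/ F * (INR (S k) * 1 * y ^ k)) by (rewrite HF; field; lra).
      apply is_derive_ext with (fun y => / F * y ^ S k);
        [intros z; unfold Rdiv; apply Rmult_comm|].
      apply is_derive_scal, is_derive_pow.
      apply (is_derive_id (K := R_AbsRing)). }
    assert (Hf0 : forall k, f (S k) 0 = 0)
      by (intros k; unfold f; simpl; unfold Rdiv; ring).
    replace (2 * S j)%nat with (S (S (2 * j))) by lia.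
    set (r := fun y => esym (S N) j * chord2 y ^ S N / cb (S N)).
    assert (Hr : forall y, 0 <= y <= PI / 3 -> Rabs (r y) <= e).
    { intros y Hy.
      assert (Hc : 1 / 2 <= cos y <= 1).
      { split; [|apply COS_bound].
        rewrite <- cos_PI3; apply cos_decr_1; lra. }
      assert (Hv : 0 <= chord2 y ^ S N <= 1).
      { unfold chord2; split; [apply pow_le; lra|].
        rewrite <- (pow1 (S N)); apply pow_incr; lra. }
      assert (Hs : 0 <= esym (S N) j <= 4).
      { split; [apply esym_nonneg|].
        apply Rle_trans with (1 := esym_le (S N) j).
        replace 4 with (2 ^ 2) by ring; apply Rle_pow; [lra|lia]. }
      assert (Hi : 0 < / cb (S N)) by apply Rinv_0_lt_compat, cb_pos.
      unfold r, e, Rdiv; rewrite Rabs_pos_eq by (apply Rmult_le_pos; [nra|lra]).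
      apply Rmult_le_compat_r; nra. }
    assert (Hd2 : forall y, 0 <= y <= PI / 3 ->
      Rabs (f (2 * j)%nat y - (arcsum N j y - r y)) <= (E + 1) * e).
    { intros y Hy.
      replace (_ - _) with ((f (2 * j)%nat y - arcsum N j y) + r y) by ring.
      eapply Rle_trans; [apply Rabs_triang|].
      pose proof (IH y ltac:(lia) Hy) as H1; pose proof (Hr y Hy); unfold f; lra. }
    assert (Hd1 : forall y, 0 <= y <= PI / 3 ->
      Rabs (f (S (2 * j)) y - arcsum' N j y) <= (E + 1) * e * y).
    { apply (abs_le_of_derive (fun y => f (S (2 * j)) y - arcsum' N j y)
        (fun y => f (2 * j)%nat y - (arcsum N j y - r y))).
      - intros y; apply (is_derive_minus (f (S (2 * j)))); [apply Hf|].
        apply is_derive_arcsum'.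
      - rewrite Hf0; unfold arcsum'.
        rewrite sum_n_zero; [ring|].
        intros n; rewrite sin_0; ring.
      - exact Hd2. }
    assert (Hd0 : forall y, 0 <= y <= PI / 3 ->
      Rabs (f (S (S (2 * j))) y - arcsum N (S j) y) <= (E + 1) * e * (4 / 3) * y).
    { apply (abs_le_of_derive (fun y => f (S (S (2 * j))) y - arcsum N (S j) y)
        (fun y => f (S (2 * j)) y - arcsum' N j y)).
      - intros y; apply (is_derive_minus (f (S (S (2 * j))))); [apply Hf|].
        apply is_derive_arcsum.
      - rewrite Hf0; unfold arcsum.
        rewrite sum_n_zero; [ring|].
        intros n; unfold chord2; rewrite cos_0; simpl; ring.
      - intros y Hy; apply Rle_trans with (1 := Hd1 y Hy).
        apply Rmult_le_compat_l; [nra|lra]. }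
    eapply Rle_trans; [apply (Hd0 x Hx)|].
    replace (2 ^ S (S j) - 2) with (2 * (E + 1)) by (unfold E; simpl; ring).
    assert (0 <= (E + 1) * e) by nra. nra.
Qed.

(** At [x = PI/3] the chord has length 1, so the powers of [chord2] disappear. *)
Lemma is_series_esym2 :
  is_series (fun n => wt n * esym n 2) (PI ^ 6 / 524880).
Proof.
  pose proof PI_RGT_0 as HPI.
  change (is_lim_seq (sum_n (fun n => wt n * esym n 2)) (PI ^ 6 / 524880)).
  apply is_lim_seq_ext with (fun N => PI ^ 6 / 524880
    - ((PI / 3) ^ (2 * 3) / INR (fact (2 * 3)) - arcsum N 3 (PI / 3))).
  - intros N; unfold arcsum, chord2; rewrite cos_PI3.
    rewrite (sum_n_ext _ (fun n => wt n * esym n 2)).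
    + change (fact (2 * 3)) with 720%nat.
      replace (INR 720) with 720 by (rewrite INR_IZR_INZ; reflexivity).
      change (2 * 3)%nat with 6%nat. field.
    + intros n; replace (2 - 2 * (1 / 2)) with 1 by field; rewrite pow1; apply Rmult_1_r.
  - replace (PI ^ 6 / 524880) with (PI ^ 6 / 524880 - 0) at 1 by ring.
    apply is_lim_seq_minus'; [apply is_lim_seq_const|].
    apply is_lim_seq_squeeze0 with (fun N => (2 ^ 4 - 2) * 4 * / cb (S N)).
    + intros N; rewrite Rmult_assoc; apply (arcsum_error N 3); [lia|lra].
    + replace 0 with ((2 ^ 4 - 2) * 4 * 0) by ring.
      apply (is_lim_seq_scal_l _ _ 0), (is_lim_seq_incr_1 (fun N => / cb N)), is_lim_seq_inv_cb.
Qed.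

(** * The values of zeta(6) and eta(6) *)

Definition cosmom (m n : nat) : R := RInt (fun t => t ^ m * cos t ^ n) 0 (PI / 2).

Lemma continuous_pow_cos (m n : nat) (t : R) : continuous (fun t => t ^ m * cos t ^ n) t.
Proof. apply (ex_derive_continuous (fun t => t ^ m * cos t ^ n)); auto_derive; exact I. Qed.

Lemma ex_RInt_pow_cos (m n : nat) (a b : R) : ex_RInt (fun t => t ^ m * cos t ^ n) a b.
Proof. apply (ex_RInt_continuous (V := R_CompleteNormedModule)); intros; apply continuous_pow_cos. Qed.

Lemma is_RInt_cosmom (m n : nat) :
  is_RInt (fun t => t ^ m * cos t ^ n) 0 (PI / 2) (cosmom m n).
Proof. apply (RInt_correct (V := R_CompleteNormedModule)), ex_RInt_pow_cos. Qed.

Lemma cosmom_0 (m : nat) : cosmom m 0 = (PI / 2) ^ S m / INR (S m).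
Proof.
  pose proof (INR_S_pos m) as Hm.
  apply is_RInt_unique.
  replace ((PI / 2) ^ S m / INR (S m))
    with (@minus R_AbelianGroup ((PI / 2) ^ S m / INR (S m)) (0 ^ S m / INR (S m)))
    by (rewrite (pow_i (S m)) by lia;
        change ((PI / 2) ^ S m / INR (S m) - 0 / INR (S m) = (PI / 2) ^ S m / INR (S m));
        field; lra).
  apply (is_RInt_derive (fun t => t ^ S m / INR (S m))).
  - intros t _.
    apply is_derive_ext with (fun t => / INR (S m) * t ^ S m);
      [intros z; unfold Rdiv; apply Rmult_comm|].
    replace (t ^ m * cos t ^ 0) with (/ INR (S m) * (INR (S m) * 1 * t ^ m))
      by (simpl (cos t ^ 0); field; lra).
    apply is_derive_scal, is_derive_pow, (is_derive_id (K := R_AbsRing)).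
  - intros t _; apply continuous_pow_cos.
Qed.

Lemma is_derive_Rmult (f g : R -> R) (x df dg : R) :
  is_derive f x df -> is_derive g x dg ->
  is_derive (fun t => f t * g t) x (df * g x + f x * dg).
Proof. intros Hf Hg; apply (is_derive_mult f g x df dg Hf Hg Rmult_comm). Qed.

Lemma is_derive_pow_S (k : nat) (x : R) :
  is_derive (fun t => t ^ S k) x (INR (S k) * x ^ k).
Proof.
  replace (INR (S k) * x ^ k) with (INR (S k) * 1 * x ^ k) by ring.
  apply is_derive_pow, (is_derive_id (K := R_AbsRing)).
Qed.

Lemma is_derive_cos_pow_S (k : nat) (x : R) :
  is_derive (fun t => cos t ^ S k) x (- (INR (S k) * (cos x ^ k * sin x))).
Proof.
  replace (- _) with (INR (S k) * - sin x * cos x ^ k) by ring.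
  apply is_derive_pow, is_derive_cos.
Qed.

Lemma is_derive_cos_pow_sin (k : nat) (x : R) :
  is_derive (fun t => cos t ^ S k * sin t) x
    ((INR k + 2) * cos x ^ S (S k) - (INR k + 1) * cos x ^ k).
Proof.
  replace (_ - _) with (- (INR (S k) * (cos x ^ k * sin x)) * sin x + cos x ^ S k * cos x).
  - apply is_derive_Rmult; [apply is_derive_cos_pow_S|apply is_derive_sin].
  - pose proof (sin2_cos2 x) as E; unfold Rsqr in E.
    rewrite S_INR; simpl (cos x ^ S _).
    replace (- _ * sin x) with (- ((INR k + 1) * cos x ^ k * (sin x * sin x))) by ring.
    replace (sin x * sin x) with (1 - cos x * cos x) by lra. ring.
Qed.

Lemma RInt_derive_0 (h dh : R -> R) (l : R) :
  (forall t, is_derive h t (dh t)) -> (forall t, continuous dh t) ->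
  h 0 = h (PI / 2) -> is_RInt dh 0 (PI / 2) l -> l = 0.
Proof.
  intros Hd Hc Hh Hl.
  assert (H : is_RInt dh 0 (PI / 2) (minus (h (PI / 2)) (h 0)))
    by (apply (is_RInt_derive h); intros; [apply Hd|apply Hc]).
  rewrite <- (is_RInt_unique _ _ _ _ Hl), (is_RInt_unique _ _ _ _ H), Hh.
  unfold minus, plus, opp; simpl; ring.
Qed.

Lemma cosmom_0_rec (n : nat) :
  (2 * INR n + 1) * cosmom 0 (2 * n) = (2 * INR n + 2) * cosmom 0 (2 * S n).
Proof.
  replace (2 * S n)%nat with (S (S (2 * n))) by lia.
  set (k := (2 * n)%nat).
  assert (Hk : INR k = 2 * INR n) by (unfold k; rewrite mult_INR; reflexivity).
  rewrite <- Hk; apply Rminus_diag_uniq_sym.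
  apply RInt_derive_0 with (h := fun t => cos t ^ S k * sin t)
    (dh := fun t => (INR k + 2) * (t ^ 0 * cos t ^ S (S k)) - (INR k + 1) * (t ^ 0 * cos t ^ k)).
  - intros t; replace (_ - _) with ((INR k + 2) * cos t ^ S (S k) - (INR k + 1) * cos t ^ k)
      by (simpl (t ^ 0); ring).
    apply is_derive_cos_pow_sin.
  - intros t; apply (continuous_minus (V := R_NormedModule));
      apply (continuous_scal_r (V := R_NormedModule)), continuous_pow_cos.
  - rewrite cos_PI2, sin_0, pow_i by lia; ring.
  - apply (is_RInt_minus (V := R_NormedModule)); apply (is_RInt_scal (V := R_NormedModule)), is_RInt_cosmom.
Qed.

(** Integration by parts twice: the integrand of the difference of both sides is
    the derivative of a function that vanishes at 0 and at [PI/2]. *)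
Lemma cosmom_rec (m n : nat) :
  (2 * INR n + 2) * (2 * INR n + 1) * cosmom (S (S m)) (2 * n)
    - (2 * INR n + 2) ^ 2 * cosmom (S (S m)) (2 * S n)
  = (INR m + 2) * (INR m + 1) * cosmom m (2 * S n).
Proof.
  replace (2 * S n)%nat with (S (S (2 * n))) by lia.
  set (k := (2 * n)%nat).
  assert (Hk : INR k = 2 * INR n) by (unfold k; rewrite mult_INR; reflexivity).
  rewrite <- Hk; apply Rminus_diag_uniq.
  apply RInt_derive_0 with
    (h := fun t => - (INR k + 2) * (t ^ S (S m) * (cos t ^ S k * sin t))
       - (INR m + 2) * (t ^ S m * cos t ^ S (S k)))
    (dh := fun t => (INR k + 2) * (INR k + 1) * (t ^ S (S m) * cos t ^ k)
       - (INR k + 2) ^ 2 * (t ^ S (S m) * cos t ^ S (S k))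
       - (INR m + 2) * (INR m + 1) * (t ^ m * cos t ^ S (S k))).
  - intros t.
    replace (_ - _) with
      (- (INR k + 2) * (INR (S (S m)) * t ^ S m * (cos t ^ S k * sin t)
         + t ^ S (S m) * ((INR k + 2) * cos t ^ S (S k) - (INR k + 1) * cos t ^ k))
       - (INR m + 2) * (INR (S m) * t ^ m * cos t ^ S (S k)
         + t ^ S m * - (INR (S (S k)) * (cos t ^ S k * sin t)))).
    + apply (is_derive_minus (V := R_NormedModule)); apply is_derive_scal.
      * apply (is_derive_Rmult (fun t => t ^ S (S m)) (fun t => cos t ^ S k * sin t));
          [apply is_derive_pow_S|apply is_derive_cos_pow_sin].
      * apply (is_derive_Rmult (fun t => t ^ S m) (fun t => cos t ^ S (S k)));
          [apply is_derive_pow_S|apply is_derive_cos_pow_S].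
    + rewrite !S_INR; simpl; ring.
  - intros t; apply (continuous_minus (V := R_NormedModule));
      [apply (continuous_minus (V := R_NormedModule))|];
      apply (continuous_scal_r (V := R_NormedModule)), continuous_pow_cos.
  - rewrite cos_PI2, !pow_i by lia; ring.
  - apply (is_RInt_minus (V := R_NormedModule));
      [apply (is_RInt_minus (V := R_NormedModule))|];
      apply (is_RInt_scal (V := R_NormedModule)), is_RInt_cosmom.
Qed.

Lemma cosmom_0_pos (n : nat) : 0 < cosmom 0 (2 * n).
Proof.
  induction n as [|n IH].
  - change (2 * 0)%nat with O; rewrite cosmom_0; simpl; pose proof PI_RGT_0; lra.
  - pose proof (cosmom_0_rec n) as E; pose proof (pos_INR n).
    assert (0 < (2 * INR n + 1) * cosmom 0 (2 * n)) by (apply Rmult_lt_0_compat; lra).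
    apply Rmult_lt_reg_l with (2 * INR n + 2); lra.
Qed.

(** The moment of order [2j] under the normalized weight [cos^(2n)], scaled so
    that the recurrence in [n] has no constants. *)
Definition cosratio (j n : nat) : R :=
  cosmom (2 * j) (2 * n) / cosmom 0 (2 * n) * 4 ^ j / INR (fact (2 * j)).

Lemma cosratio_0 (n : nat) : cosratio 0 n = 1.
Proof.
  unfold cosratio; change (2 * 0)%nat with O; change (INR (fact 0)) with 1.
  pose proof (cosmom_0_pos n); field; lra.
Qed.

Lemma cosratio_start (j : nat) : cosratio j 0 = PI ^ (2 * j) / INR (fact (S (2 * j))).
Proof.
  unfold cosratio; rewrite (Nat.mul_0_r 2), !cosmom_0, INR_fact_S, !pow_1.
  pose proof (INR_fact_lt_0 (2 * j)); pose proof (INR_S_pos (2 * j)); pose proof PI_RGT_0.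
  replace (4 ^ j) with (2 ^ (2 * j)) by (rewrite pow_mult; f_equal; ring).
  replace (PI ^ (2 * j)) with ((PI / 2) ^ (2 * j) * 2 ^ (2 * j))
    by (rewrite <- Rpow_mult_distr; f_equal; field).
  rewrite <- tech_pow_Rmult; change (INR 1) with 1; field; repeat split; lra.
Qed.

Lemma cosratio_rec (j n : nat) :
  cosratio (S j) n = cosratio (S j) (S n) + cosratio j (S n) / INR (S n) ^ 2.
Proof.
  unfold cosratio.
  pose proof (cosmom_rec (2 * j) n) as E; pose proof (cosmom_0_rec n) as E0.
  pose proof (cosmom_0_pos n) as P0; pose proof (cosmom_0_pos (S n)) as P1.
  pose proof (pos_INR n); pose proof (pos_INR j); pose proof (INR_fact_lt_0 (2 * j)).
  replace (2 * S j)%nat with (S (S (2 * j))) by lia.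
  rewrite !INR_fact_S, !S_INR.
  rewrite mult_INR in *; change (INR 2) with 2 in *.
  set (a := cosmom (S (S (2 * j))) (2 * n)) in *.
  set (b := cosmom (S (S (2 * j))) (2 * S n)) in *.
  set (w := cosmom (2 * j) (2 * S n)) in *.
  set (w1 := cosmom 0 (2 * S n)) in *.
  set (x := INR n) in *; set (z := INR j) in *.
  replace (cosmom 0 (2 * n)) with ((2 * x + 2) * w1 / (2 * x + 1))
    by (rewrite <- E0; field; lra).
  replace w with (((2 * x + 2) * (2 * x + 1) * a - (2 * x + 2) ^ 2 * b)
    / ((2 * z + 2) * (2 * z + 1))) by (rewrite E; field; lra).
  simpl (4 ^ S j). field; repeat split; lra.
Qed.

Lemma x_cos_le_sin (x : R) : 0 <= x <= PI / 2 -> 0 <= x * cos x <= sin x.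
Proof.
  intros Hx; split; [apply Rmult_le_pos; [lra|apply cos_ge_0; lra]|].
  destruct (MVT_gen (fun t => sin t - t * cos t) 0 x (fun t => t * sin t)) as (c & Hc & E).
  - intros t _; auto_derive; [exact I|ring].
  - intros t _; apply derivable_continuous_pt; exists (t * sin t).
    apply is_derive_Reals; auto_derive; [exact I|ring].
  - rewrite Rmin_left, Rmax_right in Hc by lra; cbv beta in E.
    rewrite sin_0 in E.
    assert (0 <= sin c) by (apply sin_ge_0; lra).
    assert (0 <= c * sin c * (x - 0)) by (apply Rmult_le_pos; [apply Rmult_le_pos|]; lra).
    lra.
Qed.

Lemma cosmom_nonneg (m n : nat) : 0 <= cosmom m n.
Proof.
  pose proof PI_RGT_0.
  apply RInt_ge_0; [lra|apply ex_RInt_pow_cos|].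
  intros t Ht; apply Rmult_le_pos; apply pow_le; [lra|apply cos_ge_0; lra].
Qed.

(** From [t cos t <= sin t] one gets [t^2 cos^2 t <= 1 - cos^2 t], and
    [t^2 <= 4] on the interval takes care of the remaining powers of [t]. *)
Lemma cosmom_le (j n : nat) :
  cosmom (2 * S j) (2 * S n) <= 4 ^ j * (cosmom 0 (2 * n) - cosmom 0 (2 * S n)).
Proof.
  pose proof PI_RGT_0; pose proof PI_4.
  apply (is_RInt_le (fun t => t ^ (2 * S j) * cos t ^ (2 * S n))
    (fun t => 4 ^ j * (t ^ 0 * cos t ^ (2 * n) - t ^ 0 * cos t ^ (2 * S n))) 0 (PI / 2));
    [lra|apply is_RInt_cosmom| |].
  - apply (is_RInt_scal (V := R_NormedModule)), (is_RInt_minus (V := R_NormedModule));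
      apply is_RInt_cosmom.
  - intros t Ht.
    assert (Hs := x_cos_le_sin t ltac:(lra)).
    replace (2 * S j)%nat with (2 * j + 2)%nat by lia.
    replace (2 * S n)%nat with (2 * n + 2)%nat by lia.
    rewrite !pow_add, !pow_mult; simpl (t ^ 0).
    assert (H1 : 0 <= (t ^ 2) ^ j <= 4 ^ j).
    { split; [apply pow_le; nra|apply pow_incr; split; nra]. }
    assert (H2 : 0 <= (cos t ^ 2) ^ n) by (apply pow_le; nra).
    assert (H3 : t ^ 2 * cos t ^ 2 <= 1 - cos t ^ 2).
    { pose proof (sin2_cos2 t) as E; unfold Rsqr in E. nra. }
    replace ((t ^ 2) ^ j * t ^ 2 * ((cos t ^ 2) ^ n * cos t ^ 2))
      with ((t ^ 2) ^ j * ((cos t ^ 2) ^ n * (t ^ 2 * cos t ^ 2))) by ring.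
    apply Rmult_le_compat; [lra| |lra|].
    + apply Rmult_le_pos; [assumption|nra].
    + replace (1 * _ - _) with ((cos t ^ 2) ^ n * (1 - cos t ^ 2)) by ring.
      apply Rmult_le_compat_l; assumption.
Qed.

(** The difference of two consecutive integrals of [cos^(2n)] is of order [1/n]
    relative to either of them. *)
Lemma is_lim_cosratio (j : nat) : is_lim_seq (cosratio (S j)) 0.
Proof.
  apply is_lim_seq_incr_1.
  set (K := 4 ^ j * (4 ^ S j / INR (fact (2 * S j)))).
  apply is_lim_seq_squeeze0 with (fun n => K * / INR (S n)).
  - intros n; unfold cosratio.
    pose proof (cosmom_le j n) as L; pose proof (cosmom_nonneg (2 * S j) (2 * S n)) as L0.
    pose proof (cosmom_0_rec n) as E0; pose proof (pos_INR n).
    pose proof (cosmom_0_pos (S n)) as P1; pose proof (INR_S_ge1 n).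
    set (w := cosmom 0 (2 * S n)) in *; set (a := cosmom (2 * S j) (2 * S n)) in *.
    assert (H4 : 0 < 4 ^ j) by (apply pow_lt; lra).
    assert (HF : 0 < 4 ^ S j / INR (fact (2 * S j)))
      by (apply Rdiv_lt_0_compat; [apply pow_lt; lra|apply INR_fact_lt_0]).
    assert (Ha : a <= 4 ^ j * (w * / INR (S n))).
    { apply Rle_trans with (1 := L), Rmult_le_compat_l; [lra|].
      replace (cosmom 0 (2 * n)) with ((2 * INR n + 2) * w / (2 * INR n + 1))
        by (rewrite <- E0; field; lra).
      replace (_ - w) with (w * / (2 * INR n + 1)) by (field; lra).
      apply Rmult_le_compat_l; [lra|]. apply Rinv_le_contravar; rewrite S_INR; lra. }
    replace (a / w * 4 ^ S j / INR (fact (2 * S j)))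
      with (a * / w * (4 ^ S j / INR (fact (2 * S j)))) by (unfold Rdiv; ring).
    assert (Hw : 0 < / w) by (apply Rinv_0_lt_compat, P1).
    rewrite Rabs_pos_eq by (apply Rmult_le_pos; [apply Rmult_le_pos|]; lra).
    replace (K * / INR (S n)) with (4 ^ j * (w * / INR (S n)) * / w * (4 ^ S j / INR (fact (2 * S j))))
      by (unfold K; field; repeat split; try lra; apply INR_fact_neq_0).
    apply Rmult_le_compat_r; [lra|]. apply Rmult_le_compat_r; lra.
  - replace 0 with (K * 0) by ring.
    apply (is_lim_seq_scal_l _ _ 0), is_lim_seq_inv_S.
Qed.

(** In [sum_i cosratio i n * esym n (j-i)], the recurrences of both
    families cancel when [n] increases, so the sum keeps its value at [n = 0]. *)
Lemma esym_cosratio (n : nat) :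
  esym n 1 + cosratio 1 n = PI ^ 2 / 6 /\
  esym n 2 + cosratio 1 n * esym n 1 + cosratio 2 n = PI ^ 4 / 120 /\
  esym n 3 + cosratio 1 n * esym n 2 + cosratio 2 n * esym n 1 + cosratio 3 n
    = PI ^ 6 / 5040.
Proof.
  induction n as [|n (I1 & I2 & I3)].
  - rewrite !cosratio_start; cbn [esym].
    replace (INR (fact (S (2 * 1)))) with 6 by (simpl; ring).
    replace (INR (fact (S (2 * 2)))) with 120 by (rewrite INR_IZR_INZ; reflexivity).
    replace (INR (fact (S (2 * 3)))) with 5040 by (rewrite INR_IZR_INZ; reflexivity).
    repeat split; simpl (2 * _)%nat; ring.
  - rewrite <- I1, <- I2, <- I3, !(cosratio_rec _ n), cosratio_0, !esym_S, esym_0.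
    repeat split; unfold Rdiv; ring.
Qed.

Lemma is_lim_esym :
  is_lim_seq (fun n => esym n 1) (PI ^ 2 / 6) /\
  is_lim_seq (fun n => esym n 2) (PI ^ 4 / 120) /\
  is_lim_seq (fun n => esym n 3) (PI ^ 6 / 5040).
Proof.
  pose proof (is_lim_cosratio 0) as R1; pose proof (is_lim_cosratio 1) as R2;
    pose proof (is_lim_cosratio 2) as R3.
  assert (L1 : is_lim_seq (fun n => esym n 1) (PI ^ 2 / 6)).
  { apply is_lim_seq_ext with (fun n => PI ^ 2 / 6 - cosratio 1 n).
    - intros n; destruct (esym_cosratio n) as (E & _); lra.
    - replace (PI ^ 2 / 6) with (PI ^ 2 / 6 - 0) at 1 by ring.
      apply is_lim_seq_minus'; [apply is_lim_seq_const|assumption]. }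
  assert (L2 : is_lim_seq (fun n => esym n 2) (PI ^ 4 / 120)).
  { apply is_lim_seq_ext with (fun n => PI ^ 4 / 120 - cosratio 1 n * esym n 1 - cosratio 2 n).
    - intros n; destruct (esym_cosratio n) as (_ & E & _); lra.
    - replace (PI ^ 4 / 120) with (PI ^ 4 / 120 - 0 * (PI ^ 2 / 6) - 0) at 1 by ring.
      repeat first [apply is_lim_seq_minus' | apply is_lim_seq_mult'
        | apply is_lim_seq_const | assumption]. }
  repeat split; try assumption.
  apply is_lim_seq_ext with (fun n => PI ^ 6 / 5040 - cosratio 1 n * esym n 2
    - cosratio 2 n * esym n 1 - cosratio 3 n).
  - intros n; destruct (esym_cosratio n) as (_ & _ & E); lra.
  - replace (PI ^ 6 / 5040) with
      (PI ^ 6 / 5040 - 0 * (PI ^ 4 / 120) - 0 * (PI ^ 2 / 6) - 0) at 1 by ring.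
    repeat first [apply is_lim_seq_minus' | apply is_lim_seq_mult'
      | apply is_lim_seq_const | assumption].
Qed.

Lemma sum_inv_pow6_newton (n : nat) :
  sum_n (fun i => 1 / INR (S i) ^ 6) n
  = esym (S n) 1 ^ 3 - 3 * esym (S n) 1 * esym (S n) 2 + 3 * esym (S n) 3.
Proof.
  induction n as [|n IH].
  - rewrite sum_O; simpl; field.
  - rewrite sum_Sn, IH, !(esym_S (S n)), esym_0; unfold plus; cbn -[INR pow esym].
    field; apply not_0_INR; lia.
Qed.

Lemma is_series_zeta6 : is_series (fun i => 1 / INR (S i) ^ 6) (PI ^ 6 / 945).
Proof.
  destruct is_lim_esym as (L1 & L2 & L3).
  change (is_lim_seq (sum_n (fun i => 1 / INR (S i) ^ 6)) (PI ^ 6 / 945)).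
  apply is_lim_seq_ext with (fun n => esym (S n) 1 * (esym (S n) 1 * esym (S n) 1)
    - 3 * (esym (S n) 1 * esym (S n) 2) + 3 * esym (S n) 3).
  - intros n; rewrite sum_inv_pow6_newton; ring.
  - apply (is_lim_seq_incr_1 (fun n => esym n 1 * (esym n 1 * esym n 1)
      - 3 * (esym n 1 * esym n 2) + 3 * esym n 3)).
    replace (PI ^ 6 / 945) with (PI ^ 2 / 6 * (PI ^ 2 / 6 * (PI ^ 2 / 6))
      - 3 * (PI ^ 2 / 6 * (PI ^ 4 / 120)) + 3 * (PI ^ 6 / 5040)) by field.
    apply is_lim_seq_plus'.
    + repeat first [assumption | apply is_lim_seq_const | apply is_lim_seq_minus'
        | apply is_lim_seq_mult'].
    + apply is_lim_seq_mult'; [apply is_lim_seq_const|assumption].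
Qed.

(** The even-indexed terms of the sum of [1/j^6] form [1/64] of the sum over the
    first half, and they are subtracted twice. *)
Lemma sum_alternating_pow6 (n : nat) :
  sum_n (fun i => (-1) ^ i / INR (S i) ^ 6) (S (2 * n))
  = sum_n (fun i => 1 / INR (S i) ^ 6) (S (2 * n))
    - / 32 * sum_n (fun i => 1 / INR (S i) ^ 6) n.
Proof.
  induction n as [|n IH].
  - change (S (2 * 0)) with 1%nat; rewrite !sum_Sn, !sum_O; unfold plus; simpl; field.
  - replace (S (2 * S n)) with (S (S (S (2 * n)))) by lia.
    rewrite !(sum_Sn _ (S (S (2 * n)))), !(sum_Sn _ (S (2 * n))), (sum_Sn _ n), IH.
    assert (E : (-1) ^ S (S (2 * n)) = 1).
    { change ((-1) ^ S (S (2 * n))) with (-1 * (-1 * (-1) ^ (2 * n))).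
      rewrite pow_mult; replace ((-1) ^ 2) with 1 by ring; rewrite pow1; ring. }
    change ((-1) ^ S (S (S (2 * n)))) with (-1 * (-1) ^ S (S (2 * n))); rewrite E.
    pose proof (pos_INR n).
    unfold plus; cbn -[INR pow sum_n Nat.mul].
    rewrite !S_INR, mult_INR; change (INR 2) with 2.
    field; split; lra.
Qed.

Lemma Series_eta6 :
  Series (fun i => (-1) ^ i / INR (S i) ^ 6) = 31 / 32 * (PI ^ 6 / 945).
Proof.
  pose proof is_series_zeta6 as Hz.
  assert (Hex : ex_series (fun i => (-1) ^ i / INR (S i) ^ 6)).
  { apply ex_series_Rabs_le with (fun i => 1 / INR (S i) ^ 6); [|exists (PI ^ 6 / 945); exact Hz].
    intros i; unfold Rdiv; rewrite Rabs_mult, pow_1_abs.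
    rewrite Rabs_pos_eq; [lra|]. apply Rlt_le, Rinv_0_lt_compat, pow_lt, INR_S_pos. }
  apply Series_correct in Hex.
  change (is_lim_seq (sum_n (fun i => 1 / INR (S i) ^ 6)) (PI ^ 6 / 945)) in Hz.
  change (is_lim_seq (sum_n (fun i => (-1) ^ i / INR (S i) ^ 6))
    (Series (fun i => (-1) ^ i / INR (S i) ^ 6))) in Hex.
  assert (Hsub : filterlim (fun n => S (2 * n)) eventually eventually).
  { apply eventually_subseq; intros n; lia. }
  assert (H1 := is_lim_seq_subseq _ _ _ Hsub Hex).
  assert (H2 := is_lim_seq_subseq _ _ _ Hsub Hz).
  assert (H3 : is_lim_seq (fun n => sum_n (fun i => (-1) ^ i / INR (S i) ^ 6) (S (2 * n)))
    (PI ^ 6 / 945 - / 32 * (PI ^ 6 / 945))).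
  { apply is_lim_seq_ext with (1 := fun n => eq_sym (sum_alternating_pow6 n)).
    apply is_lim_seq_minus'; [exact H2|].
    apply is_lim_seq_mult'; [apply is_lim_seq_const|exact Hz]. }
  apply is_lim_seq_unique in H1; apply is_lim_seq_unique in H3.
  rewrite H1 in H3; apply Rbar_finite_eq in H3; lra.
Qed.

(** * The evaluation *)

(* [is_series] indexes from 0, so the sum over k >= 1 is taken at k = S n.
   [Binomial.C m j] is m choose j as a real number; it is qualified because
   Coquelicot's [C] is the type of complex numbers. *)
Theorem mainTheorem18 :
  is_series (fun n : nat =>
      (3 * S4 (S n) - 1 / INR (S n) ^ 4) /
      (INR (S n) ^ 2 * Binomial.C (2 * S n) (S n)))
    (163 * PI ^ 6 / 136080).
Proof.
  pose proof is_series_alternating_coeff2 as HA; pose proof is_series_even_coeff2 as HB.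
  pose proof is_series_esym2 as HC.
  rewrite Series_eta6 in HA; rewrite (is_series_unique _ _ is_series_zeta6) in HB.
  apply (is_series_scal_l (3 / 4)) in HA; apply (is_series_scal_l (1 / 3)) in HB.
  apply (is_series_scal_l (27 / 4)) in HC.
  replace (163 * PI ^ 6 / 136080) with (3 / 4 * (2 * (31 / 32 * (PI ^ 6 / 945)))
    - 1 / 3 * (PI ^ 6 / 945) + 27 / 4 * (PI ^ 6 / 524880)) by field.
  pose proof (is_series_plus _ _ _ _ (is_series_minus _ _ _ _ HA HB) HC) as H.
  refine (is_series_ext _ _ _ _ H); clear H.
  intros n; unfold minus, plus, opp, scal; cbn -[INR pow esym S4 wt].
  change (Binomial.C _ (S n)) with (cb (S n)).
  rewrite S4_S; unfold wt, mult; cbn -[INR pow esym S4].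
  pose proof (cb_pos (S n)); pose proof (INR_S_pos n).
  field; lra.
Qed.
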